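(* A weighted graph $\Omega$ is 4-saturating if and only if $\Omega$ belongs to one of the Types S1–S13 or W1–W10 listed in the context.
   Context: A weighted graph is a finite simple graph (its base) in which every vertex $i$ has a positive integer weight $a_i$. Simple graphs are regarded as weighted graphs with all weights one. A matching of $\Omega$ is a family of edges (not necessarily different) in which each vertex appears no more times than its weight; $\nu(\Omega)$ is the largest number of edges in a matching. $N_\Omega(i)$ is the set of vertices adjacent to $i$, $\deg_\Omega(i)=\sum_{j\in N_\Omega(i)}a_j$, and $\Omega-N$ is the induced weighted subgraph obtained by deleting the vertices in $N$. For a positive integer $t$, $\Omega$ is $t$-saturating if (i) $\nu(\Omega)<t$ and (ii) $\nu(\Omega-N_\Omega(i))\ge t-\deg_\Omega(i)$ for all vertices $i$ of $\Omega$. ''$\Omega$ is spanned by $H$'' means that $H$ is a subgraph of (the base of) $\Omega$ with the same vertex set (extra edges are allowed). Vertices whose weight is not specified have weight 1. ''Meeting at a vertex'' means sharing exactly that vertex. Types with trivial weights (all weights one): S1: $\Omega$ is $K_5$. S2: $\Omega$ is spanned by a cone on a 5-cycle (a 5-cycle plus a sixth vertex joined to all its vertices). S3: $\Omega$ is spanned by a union of four triangles: six vertices $i,j,p,q,u,v$ and the triangles $\{i,p,q\},\{j,p,q\},\{i,u,v\},\{j,u,v\}$. S4: $\Omega$ is spanned by a triangular prism. S5: $\Omega$ is a disjoint union (no edges between the parts) of a triangle and a graph spanned by a 5-cycle $C_5$. S6: $\Omega$ is a disjoint union of a triangle and a graph spanned by two triangles meeting at a vertex. S7: $\Omega$ is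 a disjoint union of a triangle and a $K_4$. S8: $\Omega$ is spanned by a 7-cycle $C_7$. S9: $\Omega$ is spanned by a union of a triangle and a pentagon meeting at a vertex. S10: $\Omega$ is spanned by a union of two pentagons sharing a path of length 2 (exactly; 7 vertices). S11: $\Omega$ is spanned by a union of three triangles meeting at one common vertex (7 vertices). S12: $\Omega$ is spanned by two disjoint triangles connected by a path of length 2 (one endpoint of the path in each triangle, the midpoint outside both; 7 vertices). S13: $\Omega$ is a disjoint union of three triangles. Types with non-trivial weights: W1: $\Omega$ is a triangle with weights $(2,2,2)$, $(3,2,2)$ or $(3,3,1)$. W2: $\Omega$ is spanned by a union of a triangle $\{x,a,b\}$ and an edge $\{x,y\}$ (4 vertices) with one of the weightings: $x=3,y=2,a=b=1$; $x=3,a=2,b=y=1$; $x=a=b=2,y=1$. W3: $\Omega$ is spanned by a union of a triangle and two edges (5 vertices), namely one of: triangle $\{a,b,x\}$ with edges $\{x,u\},\{u,v\}$, where $x$ and $u$ have weight 2; triangle $\{x_1,x_2,z\}$ with edges $\{x_1,y_1\},\{x_2,y_2\}$, where $x_1$ and $x_2$ have weight 2; triangle $\{a,b,x\}$ with edges $\{x,y_1\},\{x,y_2\}$, where $x$ has weight 3. W4: $\Omega$ is spanned by a union of two triangles, namely one of: two triangles sharing exactly an edge, both of whose vertices have weight 2; two triangles meeting at a vertex of weight 2; two triangles meeting at a vertex of weight 2, with exactly one further vertex of weight 2; two triangles meeting at a vertex of weight 1, where the other two vertices of one of the triangles have weight 2. W5: $\Omega$ is spanned by a union of two triangles and an edge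 (6 vertices, exactly one vertex of weight 2), namely one of: two triangles meeting at a vertex $c$ of weight 2 and an edge from $c$ to a sixth vertex; two triangles meeting at a vertex and an edge joining a vertex $m\neq$ the common vertex, $m$ of weight 2, to a sixth vertex; two disjoint triangles joined by an edge one of whose endpoints has weight 2. W6: $\Omega$ is spanned by a pentagon with weights $(2,2,1,1,1)$ in cyclic order. W7: $\Omega$ is spanned by a union of a pentagon and an edge meeting at a vertex of weight 2 (6 vertices). W8: $\Omega$ is spanned by the union of a rectangle (4-cycle) and a triangle meeting at a vertex of weight 2 (6 vertices). W9: $\Omega$ is a disjoint union of a simple triangle (weights one) and a triangle with weights $(2,2,1)$. W10: $\Omega$ is a disjoint union of a simple triangle and a graph spanned by a triangle and an edge meeting at a vertex of weight 2 (4 vertices). *)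

(* Defs.v *)
From mathcomp Require Import all_boot.

Set Implicit Arguments.
Unset Strict Implicit.
Unset Printing Implicit Defensive.

Record wgraph := WGraph {
  vert :> finType;
  adj : rel vert;
  wt : vert -> nat;
  adj_sym : symmetric adj;
  adj_irr : irreflexive adj;
  wt_gt0 : forall i, 0 < wt i
}.

Section Basics.

Variable G : wgraph.
Implicit Types (i j : G) (N : {set G}).

Definition nbh i : {set G} := [set j | adj i j].

Definition wdeg i : nat := \sum_(j in nbh i) wt j.

(* An edge is the two-element set of its endpoints. *)
Definition edges : {set {set G}} :=
  [set [set p.1; p.2] | p : G * G & adj p.1 p.2].

(* A sequence, since the edges of a matching may be repeated. *)
Definition matching (s : seq {set G}) : bool :=
  all (fun E => E \in edges) s &&
  [forall i, count (fun E : {set G} => i \in E) s <= wt i].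

(* The range of k is large enough to reach every matching: see nu_max. *)
Definition nu : nat :=
  \max_(k < (\sum_(i : G) wt i).+1 |
        [exists s : k.-tuple {set G}, matching s]) k.

Definition del_vert N : finType := {i : G | i \notin N}.

Definition del_adj N : rel (del_vert N) := fun u v => adj (val u) (val v).

Definition del_wt N (u : del_vert N) : nat := wt (val u).

Fact del_adj_sym N : symmetric (@del_adj N).
Proof. by move=> u v; apply: adj_sym. Qed.

Fact del_adj_irr N : irreflexive (@del_adj N).
Proof. by move=> u; apply: adj_irr. Qed.

Fact del_wt_gt0 N (u : del_vert N) : 0 < del_wt u.
Proof. exact: wt_gt0. Qed.

Definition del N : wgraph :=
  WGraph (@del_adj_sym N) (@del_adj_irr N) (@del_wt_gt0 N).

Lemma matching_size s : matching s -> size s <= \sum_(i : G) wt i.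
Proof.
case/andP=> /allP sE /forallP sw.
apply: leq_trans (leq_sum _ (fun i _ => sw i)).
under eq_bigr do rewrite -sum1_count.
rewrite (exchange_big_dep predT) //= -sum1_size !big_seq.
apply: leq_sum => E /sE /imsetP[[x y] _ ->].
by rewrite (bigD1 x) ?set21 //= leq_addr.
Qed.

Lemma nu_max s : matching s -> size s <= nu.
Proof.
move=> ms; have lts : size s < (\sum_(i : G) wt i).+1 by apply: matching_size.
apply: (@leq_bigmax_cond _ _ (fun k : 'I__ => k : nat) (Ordinal lts)).
by apply/existsP; exists (in_tuple s).
Qed.

Lemma nu_attained : exists2 s, matching s & size s = nu.
Proof.
have P0 : [exists s : 0.-tuple {set G}, matching s].
  by apply/existsP; exists [tuple]; apply/andP; split=> //; apply/forallP.
have [k /existsP[s ms] def_nu] := @eq_bigmax_cond _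
  [pred k : 'I_(\sum_(i : G) wt i).+1 |
    [exists s : k.-tuple {set G}, matching s]] (fun k => k : nat)
  (introT card_gt0P (ex_intro _ ord0 P0)).
by exists (tval s); rewrite ?size_tuple -?def_nu.
Qed.

End Basics.

(* The subtraction in (ii) is truncated, which is harmless as nu is never
   negative. *)
Definition saturating (t : nat) (G : wgraph) : Prop :=
  nu G < t /\ forall i : G, t - wdeg i <= nu (del (nbh i)).

(* A weighted graph H on the vertices 0, ..., size w - 1 is given by its list w
   of weights and a list E of edges, each edge being listed in one direction
   only.  [spanned_by w E G] says that G is spanned by a copy of H. *)
Definition spanned_by (w : seq nat) (E : seq (nat * nat)) (G : wgraph) : Prop :=
  exists f : 'I_(size w) -> G,
    [/\ bijective f,
        forall i, wt (f i) = nth 0 w i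
      & forall i j, (val i, val j) \in E -> adj (f i) (f j)].

Definition cyc (s : seq nat) : seq (nat * nat) := zip s (rot 1 s).

Definition triangle (i j k : nat) : seq (nat * nat) := cyc [:: i; j; k].

Definition ones (n : nat) : seq nat := nseq n 1.

Definition is_complete (n : nat) (G : wgraph) : Prop :=
  [/\ #|G| = n, forall i : G, wt i = 1 & forall i j : G, i != j -> adj i j].

Definition disjoint_union (P Q : wgraph -> Prop) (G : wgraph) : Prop :=
  exists A : {set G},
    [/\ forall i j, i \in A -> j \notin A -> ~~ adj i j,
        P (del (~: A)) & Q (del A)].

Definition S1 : wgraph -> Prop := is_complete 5.

Definition S2 : wgraph -> Prop :=
  spanned_by (ones 6)
    (cyc [:: 0; 1; 2; 3; 4] ++ [:: (5, 0); (5, 1); (5, 2); (5, 3); (5, 4)]).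

(* i, j, p, q, u, v are 0, 1, 2, 3, 4, 5. *)
Definition S3 : wgraph -> Prop :=
  spanned_by (ones 6)
    (triangle 0 2 3 ++ triangle 1 2 3 ++ triangle 0 4 5 ++ triangle 1 4 5).

Definition S4 : wgraph -> Prop :=
  spanned_by (ones 6)
    (triangle 0 1 2 ++ triangle 3 4 5 ++ [:: (0, 3); (1, 4); (2, 5)]).

Definition S5 : wgraph -> Prop :=
  disjoint_union (is_complete 3)
    (spanned_by (ones 5) (cyc [:: 0; 1; 2; 3; 4])).

Definition S6 : wgraph -> Prop :=
  disjoint_union (is_complete 3)
    (spanned_by (ones 5) (triangle 0 1 2 ++ triangle 0 3 4)).

Definition S7 : wgraph -> Prop :=
  disjoint_union (is_complete 3) (is_complete 4).

Definition S8 : wgraph -> Prop :=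
  spanned_by (ones 7) (cyc [:: 0; 1; 2; 3; 4; 5; 6]).

Definition S9 : wgraph -> Prop :=
  spanned_by (ones 7) (triangle 0 1 2 ++ cyc [:: 0; 3; 4; 5; 6]).

(* The shared path is 0 - 1 - 2. *)
Definition S10 : wgraph -> Prop :=
  spanned_by (ones 7) (cyc [:: 0; 1; 2; 3; 4] ++ cyc [:: 0; 1; 2; 5; 6]).

Definition S11 : wgraph -> Prop :=
  spanned_by (ones 7) (triangle 0 1 2 ++ triangle 0 3 4 ++ triangle 0 5 6).

Definition S12 : wgraph -> Prop :=
  spanned_by (ones 7)
    (triangle 0 1 2 ++ [:: (2, 3); (3, 4)] ++ triangle 4 5 6).

Definition S13 : wgraph -> Prop :=
  disjoint_union (is_complete 3)
    (disjoint_union (is_complete 3) (is_complete 3)).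

Definition W1 (G : wgraph) : Prop :=
  [\/ spanned_by [:: 2; 2; 2] (triangle 0 1 2) G,
      spanned_by [:: 3; 2; 2] (triangle 0 1 2) G
    | spanned_by [:: 3; 3; 1] (triangle 0 1 2) G].

(* x, a, b, y are 0, 1, 2, 3. *)
Definition W2 (G : wgraph) : Prop :=
  let E := triangle 0 1 2 ++ [:: (0, 3)] in
  [\/ spanned_by [:: 3; 1; 1; 2] E G,
      spanned_by [:: 3; 2; 1; 1] E G
    | spanned_by [:: 2; 2; 2; 1] E G].

(* The vertices 0, 1, 2, 3, 4 are a, b, x, u, v in the first case,
   x1, x2, z, y1, y2 in the second and a, b, x, y1, y2 in the third. *)
Definition W3 (G : wgraph) : Prop :=
  [\/ spanned_by [:: 1; 1; 2; 2; 1] (triangle 0 1 2 ++ [:: (2, 3); (3, 4)]) G,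
      spanned_by [:: 2; 2; 1; 1; 1] (triangle 0 1 2 ++ [:: (0, 3); (1, 4)]) G
    | spanned_by [:: 1; 1; 3; 1; 1] (triangle 0 1 2 ++ [:: (2, 3); (2, 4)]) G].

Definition W4 (G : wgraph) : Prop :=
  let E := triangle 0 1 2 ++ triangle 0 3 4 in
  [\/ spanned_by [:: 2; 2; 1; 1] (triangle 0 1 2 ++ triangle 0 1 3) G,
      spanned_by [:: 2; 1; 1; 1; 1] E G,
      spanned_by [:: 2; 2; 1; 1; 1] E G
    | spanned_by [:: 1; 2; 2; 1; 1] E G].

Definition W5 (G : wgraph) : Prop :=
  let E := triangle 0 1 2 ++ triangle 0 3 4 in
  [\/ spanned_by [:: 2; 1; 1; 1; 1; 1] (E ++ [:: (0, 5)]) G,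
      spanned_by [:: 1; 2; 1; 1; 1; 1] (E ++ [:: (1, 5)]) G
    | spanned_by [:: 2; 1; 1; 1; 1; 1]
        (triangle 0 1 2 ++ triangle 3 4 5 ++ [:: (0, 3)]) G].

Definition W6 : wgraph -> Prop :=
  spanned_by [:: 2; 2; 1; 1; 1] (cyc [:: 0; 1; 2; 3; 4]).

Definition W7 : wgraph -> Prop :=
  spanned_by [:: 2; 1; 1; 1; 1; 1] (cyc [:: 0; 1; 2; 3; 4] ++ [:: (0, 5)]).

Definition W8 : wgraph -> Prop :=
  spanned_by [:: 2; 1; 1; 1; 1; 1] (cyc [:: 0; 1; 2; 3] ++ triangle 0 4 5).

Definition W9 : wgraph -> Prop :=
  disjoint_union (is_complete 3) (spanned_by [:: 2; 2; 1] (triangle 0 1 2)).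

Definition W10 : wgraph -> Prop :=
  disjoint_union (is_complete 3)
    (spanned_by [:: 2; 1; 1; 1] (triangle 0 1 2 ++ [:: (0, 3)])).

(* Main.v *)
Require Import Defs.
From mathcomp Require Import all_boot.

Set Implicit Arguments.
Unset Strict Implicit.
Unset Printing Implicit Defensive.

(** Saturation depends on the weighted graph only through its blow-up, the
    simple graph with [wt i] copies of each vertex i. The condition at a vertex
    v says that v has a packing: t disjoint pieces, each an edge or a neighbour
    of v (sat_atP). In this form it is clearly preserved when edges are added.
    A type that is not a disjoint union amounts to a list of weights, with sum
    less than 2t, and a list of edges; hence all graphs that it spans
    are saturating as soon as each vertex has a packing in the list itself, and
    this is checked by computation (saturatingbP).

    For the converse, take a maximum matching M of the blow-up, of size at most
    3. An uncovered vertex x lies on a blossom: an odd closed walk alternating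
    between edges off M and edges of M. Otherwise its neighbours are covered by
    distinct edges of M, and the matching which the condition at x provides away
    from these neighbours would either form such a walk or make M grow
    (blossom_exists). Blossoms at different uncovered vertices are disjoint, as
    M would grow again (blossoms_disjoint). So there are at most 3 uncovered
    vertices, the weight is at most 9, and for weight at least 7 the matching
    and its blossoms form one of six frames (frame_exists).

    Each frame, and each list of weights with sum at most 7 on at most 6
    vertices, is treated by an exhaustive search (searchP) which decides the
    remaining edges one by one. It gives up a branch when the edges that are
    still allowed violate the condition at some vertex, or when the edges
    already present contain a matching of size t, and it succeeds when these
    edges contain one of the types, or when an isolated triangle is certain.
    Frames of weight 8 or 9 always lead to an isolated triangle.

    Deleting an isolated triangle turns a (t + 1)-saturating graph into a
    t-saturating one (saturating_del), and adding one goes back (tight_add). So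
    the types that are disjoint unions come from the 3-saturating graphs of
    weight at most 6 and the 2-saturating graphs of weight at most 3, which the
    same search classifies. *)

(** * Matchings as lists of pairs *)

(** The endpoints, with multiplicity, of a list of edges given as pairs. *)
Definition ends (T : Type) (p : seq (T * T)) : seq T := unzip1 p ++ unzip2 p.

Section Ends.

Variable T : eqType.
Implicit Types (p : seq (T * T)) (q s N : seq T) (e : T * T).

Lemma size_ends p : size (ends p) = (size p).*2.
Proof. by rewrite size_cat !size_map addnn. Qed.

Lemma perm_ends_cons e p : perm_eq (ends (e :: p)) (e.1 :: e.2 :: ends p).
Proof. by rewrite /ends /= perm_cons -cat1s perm_catCA. Qed.

Lemma perm_ends_cat p p' : perm_eq (ends (p ++ p')) (ends p ++ ends p').
Proof.
rewrite /ends /unzip1 /unzip2 !map_cat -!catA perm_cat2l.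
by rewrite perm_catCA.
Qed.

Lemma count_ends_cons (a : pred T) e p :
  count a (ends (e :: p)) = a e.1 + a e.2 + count a (ends p).
Proof. by have /permP-> := perm_ends_cons e p; rewrite /= addnA. Qed.

Lemma mem_ends_cons e p x :
  (x \in ends (e :: p)) = [|| x == e.1, x == e.2 | x \in ends p].
Proof. by rewrite (perm_mem (perm_ends_cons e p)) !inE. Qed.

Lemma all_ends (a : pred T) p :
  all a (ends p) = all (fun e => a e.1 && a e.2) p.
Proof. by rewrite all_cat !all_map -all_predI; apply: eq_all => e. Qed.

Lemma count_ends_filter (a : pred T) (b : pred (T * T)) p :
  count a (ends (filter b p)) <= count a (ends p).
Proof.
rewrite /ends !count_cat /unzip1 /unzip2 !count_map !count_filter.
by apply: leq_add; apply: sub_count => e /andP[].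
Qed.

Lemma count_le_sum s N : count (mem N) s <= \sum_(i <- N) count_mem i s.
Proof.
elim: s => [|x s IH] /=; first by rewrite big1.
rewrite big_split /=; apply: leq_add (IH).
elim: N {IH} => [|y N IH] //; rewrite big_cons inE eq_sym [y == x]eq_sym.
by case: (x == y); rewrite //= add0n.
Qed.

(** An edge of p that meets N can be traded for one of its ends in N: so q and p
    together have at most as many members as the occurrences of N and the edges
    that avoid N. *)
Lemma packing_avoid N q p :
  {subset q <= N} ->
  size q + size p <= \sum_(i <- N) count_mem i (q ++ ends p)
                     + size [seq e <- p | (e.1 \notin N) && (e.2 \notin N)].
Proof.
move=> qN; apply: leq_trans (leq_add (count_le_sum _ _) (leqnn _)).
rewrite count_cat -addnA; apply: leq_add.
  by have /allP := qN; rewrite all_count => /eqP ->.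
elim: p => [|e p IH] //; rewrite count_ends_cons /=.
by case: (e.1 \in N); case: (e.2 \in N) => //=;
  rewrite ?addnS ?addSn ?ltnS ?add0n //; apply: leq_trans IH _;
  rewrite ?leqnSn.
Qed.

End Ends.

Section Matchings.

Variable G : wgraph.
Implicit Types (i j v : G) (s q : seq G) (p : seq (G * G)) (N : {set G}).

(** Each vertex occurs in s at most as often as its weight allows. *)
Definition fits s : bool := [forall i, count_mem i s <= wt i].

Definition adjp (e : G * G) : bool := adj e.1 e.2.

(** A matching, given by the list of its edges as pairs. *)
Definition pmatch p : bool := all adjp p && fits (ends p).

Lemma fitsP s : reflect (forall i, count_mem i s <= wt i) (fits s).
Proof. exact: forallP. Qed.

Lemma fits_perm s s' : perm_eq s s' -> fits s = fits s'.
Proof. by move=> /permP e; apply: eq_forallb => i; rewrite e. Qed.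

Lemma fits_catr s s' : fits (s ++ s') -> fits s'.
Proof.
by move=> /fitsP f; apply/fitsP=> i; apply: leq_trans (f i); rewrite count_cat leq_addl.
Qed.

Lemma fits_size s : fits s -> size s <= \sum_(i : G) wt i.
Proof.
move=> /fitsP f; apply: leq_trans (leq_sum _ (fun i _ => f i)).
elim: s {f} => [|x s IH] //=; rewrite big_split /= -add1n leq_add //.
by rewrite (bigD1 x) //= eqxx leq_addr.
Qed.

Lemma pmatch_size p : pmatch p -> (size p).*2 <= \sum_(i : G) wt i.
Proof. by case/andP=> _ /fits_size; rewrite size_ends. Qed.

Lemma pmatch_take n p : pmatch p -> pmatch (take n p).
Proof.
rewrite -{1}(cat_take_drop n p) => /andP[ap fp]; apply/andP; split.
  by move: ap; rewrite all_cat => /andP[].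
move: fp; rewrite (fits_perm (perm_ends_cat _ _)) (fits_perm (permEl (perm_catC _ _))).
exact: fits_catr.
Qed.

Lemma edges_pairs (s : seq {set G}) :
  all (fun E => E \in edges G) s ->
  exists2 p, all adjp p & s = [seq [set e.1; e.2] | e <- p].
Proof.
elim: s => [|E s IH] /=; first by exists [::].
case/andP=> /imsetP[e ae ->] /IH[p ap ->].
by exists (e :: p); rewrite //= ap andbT; rewrite inE in ae.
Qed.

Lemma count_pairs i p :
  all adjp p ->
  count (fun E : {set G} => i \in E) [seq [set e.1; e.2] | e <- p] =
  count_mem i (ends p).
Proof.
elim: p => [|e p IH] // /andP[ae /IH def_c]; rewrite count_ends_cons -def_c /= !inE.
rewrite ![_ == i]eq_sym; congr (_ + _); case: eqP => [->|] //=.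
by case: eqP => //= e12; rewrite /adjp e12 adj_irr in ae.
Qed.

Lemma pmatch_matching p :
  all adjp p -> matching [seq [set e.1; e.2] | e <- p] = pmatch p.
Proof.
move=> ap; rewrite /matching /pmatch ap.
have ->: all (fun E => E \in edges G) [seq [set e.1; e.2] | e <- p].
  by rewrite all_map; apply: sub_all ap => e ae; apply/imsetP; exists e; rewrite ?inE.
by apply: eq_forallb => i; rewrite count_pairs.
Qed.

Lemma nuP k : k <= nu G <-> exists2 p, pmatch p & size p = k.
Proof.
split=> [le_k | [p mp <-]]; last first.
  have ap : all adjp p by case/andP: mp.
  by rewrite -pmatch_matching // in mp; have := nu_max mp; rewrite size_map.
have [s ms sz] := nu_attained G.
have [p ap def_s] := edges_pairs (proj1 (andP ms)).
rewrite def_s pmatch_matching // in ms; exists (take k p).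
  exact: pmatch_take.
by rewrite size_takel // -(size_map (fun e => [set e.1; e.2])) -def_s sz.
Qed.

Lemma nu_lt k : (forall p, pmatch p -> size p < k) <-> nu G < k.
Proof.
split=> [h | lt_k p mp].
  by have [p mp <-] := (nuP (nu G)).1 (leqnn _); apply: h.
by apply: leq_ltn_trans lt_k; apply/nuP; exists p.
Qed.

End Matchings.

Section DeletedMatchings.

Variable G : wgraph.
Implicit Types (s : seq G) (p : seq (G * G)) (N : {set G}).

Lemma lift_del N s : all (fun i => i \notin N) s ->
  exists s' : seq (del N), map val s' = s.
Proof.
elim: s => [|x s IH] /=; first by exists [::].
by case/andP=> xN /IH[s' <-]; exists ((Sub x xN : del N) :: s').
Qed.

Lemma count_val N (s : seq (del N)) (u : del N) :
  count_mem (val u) (map val s) = count_mem u s.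
Proof. by rewrite count_map; apply: eq_count => x /=; rewrite (inj_eq val_inj). Qed.

Lemma fits_val N (s : seq (del N)) :
  fits s = fits (map val s).
Proof.
apply/fitsP/fitsP => f i; last by rewrite -count_val; apply: f.
have [iN|iN] := boolP (i \in N); last by have := f (Sub i iN); rewrite -count_val.
rewrite (count_memPn _) //; apply/mapP=> -[[x xN] _ /= def_i].
by rewrite def_i (negPf xN) in iN.
Qed.

Definition valp N (e : del N * del N) : G * G := (val e.1, val e.2).

Lemma ends_val N (p : seq (del N * del N)) :
  ends (map (@valp N) p) = map val (ends p).
Proof. by rewrite /ends /unzip1 /unzip2 map_cat -!map_comp. Qed.

Lemma liftp_del N p : all (fun i => i \notin N) (ends p) ->
  exists p' : seq (del N * del N), map (@valp N) p' = p.
Proof.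
rewrite all_ends; elim: p => [|[a b] p IH] /=; first by exists [::].
by case/andP=> /andP[aN bN] /IH[p' <-]; exists ((Sub a aN : del N, Sub b bN : del N) :: p').
Qed.

Lemma ends_notin N (p : seq (del N * del N)) :
  all (fun i => i \notin N) (ends (map (@valp N) p)).
Proof. by rewrite ends_val all_map; apply/allP=> x _; exact: (valP x). Qed.

Lemma nu_delP N k :
  k <= nu (del N) <->
  exists p, [/\ pmatch p, size p = k & all (fun i => i \notin N) (ends p)].
Proof.
split=> [/nuP[p mp sz] | [p [mp sz pN]]].
  exists (map (@valp N) p); split; last exact: ends_notin.
    rewrite /pmatch all_map ends_val -fits_val.
    by case/andP: mp => -> ->.
  by rewrite size_map.
have [p' def_p] := liftp_del pN; apply/nuP; exists p'; last by rewrite -sz -def_p size_map.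
by move: mp; rewrite -def_p /pmatch all_map ends_val -fits_val.
Qed.

End DeletedMatchings.

(** * Saturation at a vertex *)

Section Saturation.

(** Clause (ii) of saturation, at the vertex v. *)
Definition sat_at (t : nat) (G : wgraph) (v : G) : Prop :=
  t - wdeg v <= nu (del (nbh v)).

(** At least t pieces, each an edge or a neighbour of v, that together respect
    the weights. The edges may meet the neighbourhood of v. *)
Definition packing (t : nat) (G : wgraph) (v : G) : Prop :=
  exists q p, [/\ all (adj v) q, all (@adjp G) p, fits (q ++ ends p)
                & t <= size q + size p].

Variables (t : nat) (G : wgraph) (v : G).

Lemma sat_atP : sat_at t v <-> packing t v.
Proof.
rewrite /sat_at; split=> [/nu_delP[p [/andP[ap /fitsP fp] sz pN]] | [q [p [aq ap /fitsP f le_t]]]].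
  pose q := flatten [seq nseq (wt j) j | j <- enum (nbh v)].
  have cq i : count_mem i q = (i \in nbh v) * wt i.
    rewrite count_flatten -map_comp sumnE big_map -mem_enum.
    have := enum_uniq (nbh v).
    elim: (enum _) => [|x s IH] /=; first by rewrite big_nil.
    case/andP=> xs us; rewrite big_cons IH // inE count_nseq /= eq_sym.
    case: eqP => [-> | _] /=; last by rewrite mul0n.
    by rewrite (negPf xs) mul0n addn0.
  exists q, p; split=> //.
  - apply/allP=> x; rewrite -has_pred1 has_count cq.
    by case xv: (x \in _); rewrite // inE in xv.
  - apply/fitsP=> i; rewrite count_cat cq.
    case iv: (i \in _); last by rewrite fp.
    rewrite mul1n (count_memPn _) ?addn0 //.
    by apply: contraL iv => /(allP pN).
  have -> : size q = wdeg v.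
    rewrite size_flatten /shape -map_comp sumnE big_map /wdeg -[RHS]big_enum /=.
    by apply: eq_bigr => i _; rewrite /= size_nseq.
  by rewrite sz -leq_subLR.
pose N := enum (nbh v).
have qN : {subset q <= N} by move=> x /(allP aq); rewrite mem_enum inE.
set p0 := [seq e <- p | (e.1 \notin N) && (e.2 \notin N)].
have le_p0 : t - wdeg v <= size p0.
  rewrite leq_subLR; apply: leq_trans le_t (leq_trans (packing_avoid p qN) _).
  rewrite leq_add2r /wdeg -big_enum /=; exact: leq_sum.
apply: leq_trans le_p0 _; apply/nu_delP; exists p0; split=> //.
  apply/andP; split; first by apply/allP=> e; rewrite mem_filter => /andP[_ /(allP ap)].
  apply/fitsP=> i; apply: leq_trans (f i); rewrite [X in _ <= X]count_cat.
  by apply: leq_trans (leq_addl _ _); apply: count_ends_filter.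
by rewrite all_ends; apply/allP=> e; rewrite mem_filter !mem_enum => /andP[].
Qed.

End Saturation.

Lemma saturatingE t G :
  saturating t G <-> (forall p, @pmatch G p -> size p < t) /\ (forall v : G, packing t v).
Proof.
by split=> -[/nu_lt ? h]; split=> // v; apply/sat_atP; apply: h.
Qed.

(** * Graphs on numerical labels *)

(** Conditionals are used below in place of boolean connectives, and hasb and
    allb in place of has and all: a call-by-value evaluator then stops at the
    first test that decides the result. *)
Fixpoint hasb (T : Type) (a : T -> bool) (s : seq T) : bool :=
  if s is x :: s' then if a x then true else hasb a s' else false.

Fixpoint allb (T : Type) (a : T -> bool) (s : seq T) : bool :=
  if s is x :: s' then if a x then allb a s' else false else true.

Lemma hasbE (T : Type) (a : T -> bool) s : hasb a s = has a s.
Proof. by elim: s => //= x s ->; case: (a x). Qed.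

Lemma allbE (T : Type) (a : T -> bool) s : allb a s = all a s.
Proof. by elim: s => //= x s ->; case: (a x). Qed.

(** A graph on numerical labels is given by a list of edges, each in one of its
    two directions. *)
Notation edge := (nat * nat)%type.

Definition has_edge (E : seq edge) (i j : nat) : bool :=
  hasb (fun e : edge => let (a, b) := e in
          if eqn a i then eqn b j else if eqn a j then eqn b i else false) E.

(** The neighbours of the label i, one for each edge at i. *)
Fixpoint nbrs (E : seq edge) (i : nat) : seq nat :=
  if E is (a, b) :: E' then
    if eqn a i then b :: nbrs E' i else
    if eqn b i then a :: nbrs E' i else nbrs E' i
  else [::].

Lemma has_edgeE E i j : has_edge E i j = ((i, j) \in E) || ((j, i) \in E).
Proof.
rewrite /has_edge hasbE; elim: E => [|[a b] E IH] //=; rewrite IH !inE !xpair_eqE.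
rewrite !eqnE ![a == _]eq_sym ![b == _]eq_sym.
by case: (i =P a) (j =P a) => [<-|_] [->|_] //=; case: (_ == b); rewrite ?orbT ?orbF.
Qed.

Lemma has_edgeC E i j : has_edge E i j = has_edge E j i.
Proof. by rewrite !has_edgeE orbC. Qed.

Lemma has_edge_cat E E' i j :
  has_edge (E ++ E') i j = has_edge E i j || has_edge E' i j.
Proof. by rewrite /has_edge !hasbE has_cat. Qed.

Lemma mem_nbrs E i j : (j \in nbrs E i) = has_edge E i j.
Proof.
rewrite has_edgeE; elim: E => [|[a b] E IH] //=; rewrite !eqnE !inE !xpair_eqE.
rewrite ![a == i]eq_sym ![b == i]eq_sym.
case: (i =P a) => [<-|_]; last case: (i =P b) => [<-|_]; rewrite ?inE IH ?andbF //=.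
  by case: (i =P b) => [<-|_]; case: (j == _); rewrite ?orbT ?andbF.
by case: (j == a); rewrite ?orbT.
Qed.

Definition pieces (E : seq edge) : seq (seq nat) := [seq [:: e.1; e.2] | e <- E].

(** [use w i] decreases the entry i of w, if it is positive. *)
Fixpoint use (w : seq nat) (i : nat) : option (seq nat) :=
  match w, i with
  | [::], _ => None
  | a :: w', 0 => if a is a'.+1 then Some (a' :: w') else None
  | a :: w', i'.+1 => if use w' i' is Some w'' then Some (a :: w'') else None
  end.

(** The same for all members of p. *)
Fixpoint uses (w p : seq nat) : option (seq nat) :=
  if p is i :: p' then if use w i is Some w' then uses w' p' else None
  else Some w.

(** Are there t members of ps, repetitions allowed, that together contain each
    label i at most [nth 0 w i] times? *)
Fixpoint fit (t : nat) : seq (seq nat) -> seq nat -> bool :=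
  if t is t'.+1 then
    fix fit_head ps w :=
      if ps is p :: ps' then
        if (if uses w p is Some w' then fit t' ps w' else false) then true
        else fit_head ps' w
      else false
  else fun _ _ => true.

Lemma useP w i :
  if use w i is Some w' then
    0 < nth 0 w i /\ forall j, nth 0 w' j = nth 0 w j - (j == i)
  else nth 0 w i = 0.
Proof.
elim: w i => [|a w IH] [|i] //=.
  by case: a => [|a] //; split=> // -[|j] /=; rewrite ?subn1 ?subn0.
have := IH i; case: (use w i) => // w' [w_i w'E]; split=> // -[|j] /=.
  by rewrite subn0.
exact: w'E.
Qed.

Lemma usesP w p :
  if uses w p is Some w' then
    forall s, (forall j, count_mem j s <= nth 0 w' j) <->
              (forall j, count_mem j (p ++ s) <= nth 0 w j)
  else exists j, nth 0 w j < count_mem j p.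
Proof.
elim: p w => [|i p IH] w /=; first by [].
have := useP w i; case: (use w i) => [w1 [w_i w1E] | w_i].
  have := IH w1; case: (uses w1 p) => [w' h s | [j lt_j]].
    apply: iff_trans (h s) _; split=> c j; have := c j; rewrite w1E [i == j]eq_sym.
      case: eqP => [->|_]; last by rewrite subn0.
      by rewrite leq_subRL.
    case: eqP => [->|_]; last by rewrite subn0.
    by rewrite leq_subRL.
  exists j; move: lt_j; rewrite w1E [i == j]eq_sym.
  case: eqP => [->|_]; last by rewrite subn0.
  by rewrite ltn_subLR.
by exists i; rewrite eqxx w_i.
Qed.

Lemma fitP t ps w :
  fit t ps w <->
  exists P, [/\ size P = t, {subset P <= ps}
              & forall j, count_mem j (flatten P) <= nth 0 w j].
Proof.
elim: t ps w => [|t IHt] ps w.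
  by split=> // _; exists [::].
elim: ps w => [|p ps IHp] w.
  by split=> // -[[|p P] [//= _ sP _]]; have := sP p (mem_head _ _).
rewrite [fit _ _ _]/=; set b := (if uses _ _ is Some _ then _ else _).
have bP : b <-> exists P, [/\ size P = t, {subset P <= p :: ps}
    & forall j, count_mem j (p ++ flatten P) <= nth 0 w j].
  rewrite /b; have := usesP w p; case: (uses w p) => [w' h | [j lt_j]].
    by apply: iff_trans (IHt _ _) _; split=> -[P [sz sP c]]; exists P; split=> //; apply/h.
  split=> // -[P [_ _ /(_ j)]]; rewrite count_cat leqNgt.
  by rewrite (leq_trans lt_j) ?leq_addr.
case def_b: b.
  split=> // _; have [P [sz sP c]] := bP.1 def_b.
  exists (p :: P); split=> //=; first by rewrite sz.
  by move=> x; rewrite inE => /predU1P[->|/sP //]; rewrite mem_head.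
split=> [/IHp[P [sz sP c]] | [P [sz sP c]]].
  by exists P; split=> // x /sP; rewrite inE orbC => ->.
have [pP | pP] := boolP (p \in P); last first.
  apply/IHp; exists P; split=> // x xP; have := sP x xP; rewrite inE.
  by case/predU1P=> // def_x; rewrite -def_x xP in pP.
case/negP: (negbT def_b); apply/bP.
exists (rem p P); split; first by rewrite size_rem // sz.
  by move=> x /mem_rem /sP.
move=> j; apply: leq_trans (c j).
have /permP-> // := perm_flatten (perm_to_rem pP); exact: leqnn.
Qed.

(** The condition at the label v for the graph with weights w and edges E: some
    matching that avoids the neighbours of v completes their weight to t. If E
    has repeated edges then d may exceed the degree, so that only the failure of
    this test is conclusive. *)
Definition condb (t : nat) (w : seq nat) (E : seq edge) (v : nat) : bool :=
  let N := nbrs E v in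
  let d := sumn [seq nth 0 w i | i <- N] in
  if t <= d then true else
  fit (t - d) (pieces [seq e <- E | if hasb (eqn e.1) N then false
                                    else ~~ hasb (eqn e.2) N]) w.

(** The existence of a packing at the label v. *)
Definition packb (t : nat) (w : seq nat) (E : seq edge) (v : nat) : bool :=
  fit t ([seq [:: i] | i <- nbrs E v] ++ pieces E) w.

(** * Labellings *)

Section Labelling.

Variables (G : wgraph) (w : seq nat) (f : nat -> G).

(** f numbers the vertices of G by the labels below [size w], with weights w.
    Its other values are irrelevant. *)
Definition labelling : Prop :=
  [/\ {in gtn (size w) &, injective f},
      forall x, exists2 i, i < size w & f i = x
    & forall i, i < size w -> wt (f i) = nth 0 w i].

(** All edges of E are edges of G, under the numbering f. *)
Definition below (E : seq edge) : Prop := all (fun e : edge => adj (f e.1) (f e.2)) E.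

(** All edges of G are in E, under the numbering f. *)
Definition above (E : seq edge) : Prop :=
  forall i j, i < size w -> j < size w -> adj (f i) (f j) -> has_edge E i j.

Hypothesis lab : labelling.

Lemma labelled_inj : {in gtn (size w) &, injective f}. Proof. by case: lab. Qed.

Lemma labelled_wt i : i < size w -> wt (f i) = nth 0 w i.
Proof. by case: lab => _ _; apply. Qed.

Lemma labelled_lt i : 0 < nth 0 w i -> i < size w.
Proof. by case: (ltnP i (size w)) => // /(nth_default 0) ->. Qed.

(** The inverse of f. *)
Definition label (x : G) : nat := index x [seq f i | i <- iota 0 (size w)].

Lemma label_lt x : label x < size w.
Proof.
have [_ surj _] := lab; have [i lt_i <-] := surj x.
by rewrite -[ltnRHS](size_iota 0) -(size_map f) index_mem map_f // mem_iota.
Qed.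

Lemma labelK x : f (label x) = x.
Proof.
have lt_x := label_lt x.
rewrite -[RHS](@nth_index _ x x [seq f i | i <- iota 0 (size w)]).
  by rewrite (nth_map 0) ?size_iota // nth_iota.
by rewrite -index_mem size_map size_iota.
Qed.

Lemma wt_label x : nth 0 w (label x) = wt x.
Proof. by rewrite -labelled_wt ?label_lt // labelK. Qed.

Lemma card_labelled : #|G| = size w.
Proof.
have [inj surj _] := lab.
have u : uniq [seq f i | i <- iota 0 (size w)].
  rewrite map_inj_in_uniq ?iota_uniq // => i j; rewrite !mem_iota !add0n; exact: inj.
rewrite -[RHS](size_iota 0) -(size_map f) -(card_uniqP u); apply: eq_card => x.
have [i lt_i <-] := surj x; rewrite inE map_f // mem_iota //.
Qed.

Lemma count_labels (s : seq nat) :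
  (forall i, count_mem i s <= nth 0 w i) -> fits (map f s).
Proof.
move=> c; apply/fitsP=> x; rewrite -(wt_label x); apply: leq_trans (c _).
rewrite count_map; apply: eq_leq; apply: eq_in_count => i i_s /=.
have lt_i : i < size w.
  by apply: labelled_lt; apply: leq_trans (c i); rewrite -has_count has_pred1.
apply/eqP/eqP => [def_x | ->]; last exact: labelK.
by apply: labelled_inj; rewrite ?inE ?label_lt ?labelK.
Qed.

Lemma below_pieces E P : below E -> {subset P <= pieces E} ->
  exists p, [/\ all (@adjp G) p, size p = size P & perm_eq (ends p) (map f (flatten P))].
Proof.
move=> /allP lowE; elim: P => [|x P IH] sP; first by exists [::].
have [|p [ap sz pe]] := IH; first by move=> y yP; apply: sP; rewrite inE yP orbT.
have /mapP[e eE ->] := sP x (mem_head _ _).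
exists ((f e.1, f e.2) :: p); split=> /=; rewrite ?sz //.
  by rewrite ap andbT; apply: lowE.
by apply: perm_trans (perm_ends_cons _ _) _; rewrite !perm_cons.
Qed.

Lemma fit_pmatch t E : below E -> fit t (pieces E) w ->
  exists2 p : seq (G * G), pmatch p & size p = t.
Proof.
move=> lowE /fitP[P [<- sP c]]; have [p [ap sz pe]] := below_pieces lowE sP.
by exists p; rewrite // /pmatch ap (fits_perm pe) count_labels.
Qed.

Lemma packb_packing t E i : below E -> packb t w E i -> packing t (f i).
Proof.
move=> lowE /fitP[P [sz sP c]].
pose single := [pred x : seq nat | x \in [seq [:: j] | j <- nbrs E i]].
have [] := @below_pieces E [seq x <- P | ~~ single x] lowE.
  by move=> x; rewrite mem_filter /= => /andP[/negPf xN /sP]; rewrite mem_cat xN.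
move=> p [ap szp pe]; pose q := map f (flatten [seq x <- P | single x]).
exists q, p; split=> //.
- apply/allP=> y /mapP[j /flattenP[x xP jx] ->] {y}.
  move: xP jx; rewrite mem_filter => /andP[/mapP[k ik ->] _]; rewrite inE => /eqP ->.
  move: ik; rewrite mem_nbrs has_edgeE => ik.
  by case/orP: ik => /(allP lowE) //=; rewrite adj_sym.
- rewrite (fits_perm (s' := map f (flatten P))) ?count_labels //.
  rewrite /q (permPl (perm_cat (perm_refl _) pe)) -map_cat perm_map //.
  by rewrite -flatten_cat perm_flatten // perm_filterC.
rewrite szp -sz -(count_predC single P) !size_filter leq_add2r.
rewrite /q size_map size_flatten /shape -size_filter.
have: all single [seq x <- P | single x] by apply: filter_all.
by elim: [seq x <- P | _] => //= x s IH /andP[/mapP[j _ ->] /IH].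
Qed.

Lemma packing_condb t E i : above E -> i < size w -> packing t (f i) -> condb t w E i.
Proof.
move=> upE lt_i [q [p [/allP aq /allP ap /fitsP fp le_t]]].
rewrite /condb; set N := nbrs E i; set d := sumn _.
case: leqP => // lt_d; apply/fitP.
pose plab := [seq (label e.1, label e.2) | e <- p].
have ends_plab : ends plab = map label (ends p).
  by rewrite /ends /unzip1 /unzip2 map_cat -!map_comp.
pose p0 := [seq e <- plab | (e.1 \notin N) && (e.2 \notin N)].
have cw j : count_mem j (map label q ++ ends plab) <= nth 0 w j.
  rewrite ends_plab -map_cat; have [lt_j | ge_j] := ltnP j (size w).
    rewrite -labelled_wt // count_map; apply: leq_trans (fp (f j)).
    apply: sub_count => x /= /eqP <-; by rewrite labelK.
  by rewrite (count_memPn _) //; apply/mapP=> -[x _ def_j]; rewrite def_j leqNgt label_lt in ge_j.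
have le_p0 : t - d <= size p0.
  rewrite leq_subLR; apply: leq_trans le_t _.
  have := @packing_avoid _ N (map label q) plab; rewrite !size_map => /(_ _)/leq_trans.
  apply.
    move=> _ /mapP[x /aq ax ->]; rewrite mem_nbrs; apply: upE; rewrite ?label_lt //.
    by rewrite labelK.
  rewrite leq_add2r /d sumnE big_map; exact: leq_sum.
pose turn (e : edge) := if e \in E then e else (e.2, e.1).
pose P := [seq [:: (turn e).1; (turn e).2] | e <- take (t - d) p0].
exists P; split.
- by rewrite size_map size_takel.
- move=> z /mapP[e e_p0 -> {z}].
  have := mem_take e_p0; rewrite mem_filter => /andP[eN /mapP[[x y] /ap axy def_e]].
  apply: (map_f (fun e : edge => [:: e.1; e.2])); rewrite mem_filter !hasbE.
  have has_N k : has (eqn k) N = (k \in N).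
    by rewrite -has_pred1; apply: eq_has => l /=; rewrite eqnE eq_sym.
  have [tE tN] : turn e \in E /\ ((turn e).1 \notin N) && ((turn e).2 \notin N).
    have := upE _ _ (label_lt x) (label_lt y).
    rewrite def_e /= in eN; rewrite !labelK has_edgeE /turn def_e /= => /(_ axy).
    by case: ifP => [xyE _ | _ /= yxE]; split=> //; rewrite andbC.
  by rewrite !has_N tE andbT; case: (_ \in N) tN.
move=> j; apply: leq_trans (cw j); rewrite count_cat; apply: leq_trans (leq_addl _ _).
have -> : count_mem j (flatten P) = count_mem j (ends (take (t - d) p0)).
  rewrite /P; elim: (take _ _) => [|e s IH] //; rewrite count_ends_cons /= IH addnA.
  by rewrite /turn; case: ifP => _ //=; rewrite [_ + (e.1 == j)]addnC.
apply: (@leq_trans (count_mem j (ends p0))).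
  rewrite -{2}(cat_take_drop (t - d) p0) (permP (perm_ends_cat _ _)) count_cat.
  exact: leq_addr.
exact: count_ends_filter.
Qed.

End Labelling.

(** * Searching for a copy of a weighted graph *)

Section Embed.

Variables (w : seq nat) (E : seq edge) (w' : seq nat) (E' : seq edge).

(** s lists the images in (w, E) of the labels of (w', E'), in order. *)
Definition embedding (s : seq nat) : bool :=
  [&& size s == size w', uniq s, size w' == size w, all (gtn (size w)) s,
      all (fun i => nth 0 w (nth 0 s i) == nth 0 w' i) (iota 0 (size w'))
    & all (fun e : edge => has_edge E (nth 0 s e.1) (nth 0 s e.2)) E'].

(** Backtracking search for an embedding that extends s, where ws are the
    weights of the labels not yet placed. The tests made on the way only prune
    the search. *)
Fixpoint embed (ws s : seq nat) : bool :=
  if ws is a :: ws' then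
    hasb (fun x =>
      if hasb (eqn x) s then false else
      if eqn (nth 0 w x) a then
        let i := size s in let s' := rcons s x in
        if allb (fun e : edge => let (u, v) := e in
             if eqn u i then
               (if v <= i then has_edge E x (nth 0 s' v) else true)
             else if eqn v i then
               (if u <= i then has_edge E x (nth 0 s' u) else true)
             else true) E'
        then embed ws' s' else false
      else false) (iota 0 (size w))
  else embedding s.

Lemma embedP ws s : embed ws s -> exists s', embedding s'.
Proof.
elim: ws s => [|a ws IH] s /=; first by exists s.
rewrite hasbE => /hasP[x _]; case: (hasb _ _) => //; case: (eqn _ _) => //.
by case: (allb _ _) => // /IH.
Qed.

Lemma embedding_spanned (G : wgraph) (f : nat -> G) s :
  labelling w f -> below f E -> embedding s -> spanned_by w' E' G.
Proof.
move=> lab /allP lowE /and5P[/eqP sz us /eqP szw /allP ltw /andP[/allP wE /allP sE']].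
have lt_s (i : 'I_(size w')) : nth 0 s i < size w by apply: ltw; rewrite mem_nth ?sz.
exists (fun i : 'I_(size w') => f (nth 0 s i)); split.
- apply: inj_card_bij => [i j /(labelled_inj lab)|].
    rewrite !inE !lt_s => /(_ isT isT)/eqP; rewrite nth_uniq ?sz // => /eqP.
    exact: val_inj.
  by rewrite (card_labelled lab) card_ord szw.
- by move=> i; rewrite (labelled_wt lab) ?lt_s //; apply/eqP/wE; rewrite mem_iota ltn_ord.
move=> i j /sE' /=; rewrite has_edgeE => /orP[] /lowE //=.
by rewrite adj_sym.
Qed.

End Embed.

(** * Isolated triangles *)

(** A component that is a triangle with weights one. *)
Definition isolated_triangle (G : wgraph) : Prop :=
  exists A : {set G}, (forall i j, i \in A -> j \notin A -> ~~ adj i j)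
                   /\ is_complete 3 (del (~: A)).

Lemma triangle_vertices (G : wgraph) (A : {set G}) :
  is_complete 3 (del (~: A)) -> exists a b c,
    [/\ A = [set a; b; c], uniq [:: a; b; c],
        forall i, i \in A -> wt i = 1
      & {in A &, forall i j, i != j -> adj i j}].
Proof.
case=> cardA wA adjA.
have {}cardA : #|A| = 3.
  by rewrite -cardA card_sig; apply: eq_card => x; rewrite !inE negbK.
have sz : size (enum A) = 3 by rewrite -cardE.
case def_A: (enum A) sz (enum_uniq A) => [|a [|b [|c []]]] // _ us.
have AN i : i \in A -> i \notin ~: A by rewrite inE negbK.
exists a, b, c; split=> //.
- by apply/setP=> x; rewrite -mem_enum def_A !inE orbA.
- by move=> i /AN iA; apply: (wA (Sub i iA : del (~: A))).
move=> i j /AN iA /AN jA ij; apply: (adjA (Sub i iA : del (~: A)) (Sub j jA)).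
by rewrite -(inj_eq val_inj).
Qed.

Lemma isolated_triangleI (G : wgraph) (a b c : G) :
  wt a = 1 -> wt b = 1 -> wt c = 1 -> adj a b -> adj a c -> adj b c ->
  (forall x, adj a x -> x \in [:: b; c]) ->
  (forall x, adj b x -> x \in [:: a; c]) ->
  (forall x, adj c x -> x \in [:: a; b]) -> isolated_triangle G.
Proof.
move=> wa wb wc ab ac bc na nb nc.
have neq x y : @adj G x y -> x != y by apply: contraTneq => ->; rewrite adj_irr.
pose A := [set x in [:: a; b; c]]; exists A; split.
  move=> i j; rewrite !inE => iA; apply: contra.
  by case/or3P: iA => /eqP->; [move/na | move/nb | move/nc];
    rewrite !inE => /orP[]->; rewrite ?orbT.
have mA (u : del (~: A)) : val u \in [:: a; b; c].
  by have := valP u; rewrite !inE negbK.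
split.
- rewrite card_sig (eq_card (B := mem [:: a; b; c])); last by move=> x; rewrite !inE negbK.
  by apply/card_uniqP; rewrite /= !inE !negb_or !neq.
- by move=> u; rewrite /= /del_wt; have := mA u; rewrite !inE => /or3P[]/eqP->.
move=> u v; rewrite -(inj_eq val_inj) => uv; rewrite /= /del_adj.
move: (mA u) (mA v) uv; rewrite !inE.
by case/or3P=> /eqP->; case/or3P=> /eqP->; rewrite ?eqxx // adj_sym.
Qed.

(** Is there a triangle of edges of yes, with weights one, that no other edge of
    E meets? *)
Definition isolatedb (w : seq nat) (yes E : seq edge) : bool :=
  hasb (fun a => if nbrs E a is [:: b; c] then
          if has_edge yes b c then
            [&& has_edge yes a b, has_edge yes a c, size (nbrs E b) == 2,
                size (nbrs E c) == 2, nth 0 w a == 1, nth 0 w b == 1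
              & nth 0 w c == 1]
          else false
        else false) (iota 0 (size w)).

Lemma isolatedbP w (G : wgraph) (f : nat -> G) yes E :
  labelling w f -> below f yes -> above w f E -> {subset yes <= E} ->
  isolatedb w yes E -> isolated_triangle G.
Proof.
move=> lab /allP low up yesE; rewrite /isolatedb hasbE => /hasP[a _].
have adjf i j : has_edge yes i j -> adj (f i) (f j).
  by rewrite has_edgeE => /orP[] /low //=; rewrite adj_sym.
have nbr2 i j k x : has_edge yes i j -> has_edge yes i k -> j != k ->
    size (nbrs E i) == 2 -> i < size w -> adj (f i) x -> x \in [:: f j; f k].
  move=> ij ik jk /eqP sz lt_i; rewrite -(labelK lab x) => ax.
  have sub : {subset [:: j; k] <= nbrs E i}.
    have mono l : has_edge yes i l -> l \in nbrs E i.
      by rewrite mem_nbrs !has_edgeE => /orP[] /yesE ->; rewrite ?orbT.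
    by move=> l; rewrite !inE => /orP[] /eqP->; apply: mono.
  have u : uniq [:: j; k] by rewrite /= inE jk.
  have [|_ eqN] := uniq_min_size u sub; first by rewrite sz.
  have := up _ _ lt_i (label_lt lab x) ax; rewrite -mem_nbrs -eqN !inE.
  by case/orP=> /eqP->; rewrite eqxx ?orbT.
case def_N: (nbrs E a) => [|b [|c []]] //; case: ifP => // bc.
case/and5P=> ab ac sb sc /and3P[/eqP wa /eqP wb /eqP wc].
have sa : size (nbrs E a) == 2 by rewrite def_N.
have lt i : nth 0 w i = 1 -> i < size w by move=> wi; apply: labelled_lt; rewrite wi.
have neq i j : has_edge yes i j -> i != j.
  by apply: contraTneq => ->; apply/negP => /adjf; rewrite adj_irr.
apply: (@isolated_triangleI G (f a) (f b) (f c)); rewrite ?(labelled_wt lab) ?lt //; auto.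
- by move=> x; apply: nbr2; rewrite // ?neq ?lt.
- by move=> x; apply: nbr2; rewrite // ?neq ?lt // has_edgeC.
by move=> x; apply: nbr2; rewrite // ?neq ?lt // has_edgeC.
Qed.

(** * Exhaustive search *)

(** The edges of the complete graph on the labels below k. *)
Definition complete_edges (k : nat) : seq edge :=
  [seq (i, j) | i <- iota 0 k, j <- iota i.+1 (k - i.+1)].

Lemma complete_edgesP k i j : i < j -> j < k -> (i, j) \in complete_edges k.
Proof.
move=> ij jk; have ik := ltn_trans ij jk.
by apply: allpairs_f_dep; rewrite mem_iota //= ij subnKC.
Qed.

(** The label with the least value of m among those of u :: s. *)
Fixpoint least (m : nat -> nat) (u : nat) (s : seq nat) : nat :=
  if s is v :: s' then (if m u <= m v then least m u s' else least m v s')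
  else u.

Section Search.

Variables (t : nat) (w : seq nat) (types : seq (seq nat * seq edge)).

Let labels := iota 0 (size w).

(** The position in unk of the next edge to decide, given the list un of the
    labels at which the condition does not hold yet: an edge at the member of un
    with the fewest possible neighbours. The soundness of the search does not
    depend on this choice. *)
Definition next_edge (un : seq nat) (yes unk : seq edge) : nat :=
  if un is u :: un' then
    let v := least (fun v => size (nbrs (yes ++ unk) v)) u un' in
    let i := find (fun e : edge => if eqn e.1 v then true else eqn e.2 v) unk in
    if i < size unk then i else 0
  else 0.

(** A state of the search stands for the saturating graphs that have the edges
    yes, and possibly some of unk. It is settled if the edges at hand are too few
    for the condition at some vertex, or if yes contains a matching of size t,
    or if yes contains one of the types or is sure to have an isolated triangle.
    The flags cut and add, which only avoid repeating tests, say if the last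
    decision was to leave out, or to put in, an edge; un lists the labels at
    which the condition does not hold in the graph yes. *)
Definition settled (cut add : bool) (un : seq nat) (yes unk : seq edge) : bool :=
  if (if cut then ~~ allb (condb t w (yes ++ unk)) labels else false) then true else
  if (if add then fit t (pieces yes) w else false) then true else
  if (if 3 < size w then isolatedb w yes (yes ++ unk) else false) then true else
  if nilp un then hasb (fun T => embed w yes T.1 T.2 T.1 [::]) types else false.

(** The edges of unk are decided one after the other, to depth at most n. *)
Fixpoint search (n : nat) (cut add : bool) (yes unk : seq edge) : bool :=
  let un := [seq v <- labels | ~~ condb t w yes v] in
  if settled cut add un yes unk then true else
  if n is n'.+1 then
    let i := next_edge un yes unk in
    let e := nth (0, 0) unk i in
    let r := take i unk ++ drop i.+1 unk in
    if search n' true false yes r then search n' false true (e :: yes) r else false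
  else false.

(** G is spanned by a member of the list l. *)
Fixpoint spanned_by_one (l : seq (seq nat * seq edge)) (G : wgraph) : Prop :=
  if l is T :: l' then spanned_by T.1 T.2 G \/ spanned_by_one l' G else False.

Lemma spanned_by_oneP l G :
  spanned_by_one l G <-> exists2 T, T \in l & spanned_by T.1 T.2 G.
Proof.
elim: l => [|T l IH] /=; first by split=> // -[].
split=> [[s | /IH[T' T'l s]] | [T']].
- by exists T; rewrite ?mem_head.
- by exists T'; rewrite // inE T'l orbT.
by rewrite inE => /predU1P[-> | T'l s]; [left | right; apply/IH; exists T'].
Qed.

(** The conclusion of the search. The bound excludes that G is the triangle. *)
Definition classified (G : wgraph) : Prop :=
  spanned_by_one types G \/ 3 < #|G| /\ isolated_triangle G.

Section Soundness.

Variables (G : wgraph) (f : nat -> G).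
Hypotheses (sat : saturating t G) (lab : labelling w f).

Lemma settledP cut add un yes unk :
  below f yes -> above w f (yes ++ unk) -> settled cut add un yes unk -> classified G.
Proof.
have [nu_lt pack] := (saturatingE t G).1 sat.
move=> low up; rewrite /settled; case: ifP => [|_].
  case: cut => //; rewrite allbE => /allPn[i]; rewrite mem_iota /= add0n => lt_i.
  by case/negP; apply: (packing_condb lab up).
case: ifP => [|_].
  case: add => // /(fit_pmatch lab low)[p /nu_lt]; rewrite ltn_neqAle.
  by case/andP=> /eqP.
case: ifP => [|_].
  case: ltnP => // n3 iso _; right; split; first by rewrite (card_labelled lab).
  by apply: isolatedbP lab low up _ iso => e eyes; rewrite mem_cat eyes.
case: (nilp _) => //; rewrite hasbE => /hasP[T Tl /embedP[s emb]]; left.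
by apply/spanned_by_oneP; exists T; last exact: embedding_spanned lab low emb.
Qed.

Lemma searchP n cut add yes unk :
  below f yes -> above w f (yes ++ unk) -> search n cut add yes unk -> classified G.
Proof.
elim: n cut add yes unk => [|n IH] cut add yes unk low up.
  by rewrite /=; case: ifP => // /(settledP low up).
rewrite [search _ _ _ _ _]/=; case: ifP => [/(settledP low up) //|_].
set i := next_edge _ _ _; set e := nth _ _ _; set r := take _ _ ++ _.
have unkE : {subset unk <= e :: r}.
  move=> x; rewrite -{1}(cat_take_drop i unk) inE !mem_cat.
  have [lt_i | ge_i] := ltnP i (size unk); last first.
    by rewrite drop_oversize // orbF => ->; rewrite orbT.
  by rewrite (drop_nth (0, 0)) // inE orbCA.
clearbody r; case: ifP => // s0 s1; have [ae | nae] := boolP (adj (f e.1) (f e.2)).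
  apply: IH s1; first by rewrite /below /= ae.
  move=> j k lt_j lt_k /(up j k lt_j lt_k); rewrite !has_edgeE !mem_cat !inE.
  by case/orP=> /orP[->|/unkE]; rewrite ?orbT // inE => /orP[]->; rewrite ?orbT.
apply: IH s0 => // j k lt_j lt_k ajk.
have := up j k lt_j lt_k ajk; rewrite !has_edgeE !mem_cat.
case/orP=> /orP[->|/unkE]; rewrite ?orbT // inE => /orP[/eqP def_e|->]; rewrite ?orbT //.
  by rewrite -def_e ajk in nae.
by rewrite -def_e /= adj_sym ajk in nae.
Qed.

End Soundness.

End Search.

(** The search over all graphs with weights w that contain the edges yes, which
    are assumed to be distinct for the tests to be sharp. *)
Definition run (t : nat) (types : seq (seq nat * seq edge)) (w : seq nat)
    (yes : seq edge) : bool :=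
  let types' := [seq T <- types | perm_eq T.1 w] in
  let unk := [seq e <- complete_edges (size w) | ~~ has_edge yes e.1 e.2] in
  search t w types' (size unk) true true yes unk.

Lemma runP t types w yes (G : wgraph) (f : nat -> G) :
  saturating t G -> labelling w f -> below f yes -> run t types w yes ->
  classified types G.
Proof.
move=> sat lab low /(searchP sat lab low) [].
- move=> i j lt_i lt_j aij; rewrite has_edge_cat.
  case yij: (has_edge yes i j); rewrite //= has_edgeE !mem_filter /=.
  have yji : has_edge yes j i = false by rewrite has_edgeC.
  rewrite yij yji /=; case: (ltngtP i j) aij => [ij _ | ji _ | -> ]; last by rewrite adj_irr.
    by rewrite complete_edgesP.
  by rewrite orbC complete_edgesP.
- case/spanned_by_oneP=> T; rewrite mem_filter => /andP[_ Tl] s.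
  by left; apply/spanned_by_oneP; exists T.
by right.
Qed.

(** * The blow-up *)

Lemma fits_uniq (G : wgraph) (s : seq G) : (forall i : G, wt i = 1) -> fits s = uniq s.
Proof.
move=> w1; apply/fitsP/idP => [|us i]; last by rewrite w1 count_uniq_mem // leq_b1.
elim: s => //= x s IH c; rewrite IH ?andbT.
  by have := c x; rewrite eqxx w1 add1n ltnS leqn0 -[X in X == 0]/(count_mem x s)
                          -leqn0 leqNgt -has_count has_pred1.
by move=> i; apply: leq_trans (c i); rewrite leq_addl.
Qed.

Section BlowUp.

Variable G : wgraph.

(** The simple graph in which each vertex i of G is replaced by [wt i] copies. *)
Definition blow_vert : finType := {i : G & 'I_(wt i)}.
Definition blow_adj : rel blow_vert := fun x y => adj (tag x) (tag y).

Fact blow_sym : symmetric blow_adj. Proof. by move=> x y; apply: adj_sym. Qed.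
Fact blow_irr : irreflexive blow_adj. Proof. by move=> x; apply: adj_irr. Qed.

Definition blow : wgraph :=
  @WGraph blow_vert blow_adj (fun=> 1) blow_sym blow_irr (fun=> isT).

(** The copies of the vertex i. *)
Definition copies (i : G) : seq blow := [seq Tagged (fun i => 'I_(wt i)) c | c : 'I_(wt i)].

Lemma mem_copies i (x : blow) : (x \in copies i) = (tag x == i).
Proof.
apply/imageP/eqP => [[c _ ->] // | <-]; exists (tagged x) => //.
by case: x.
Qed.

Lemma size_copies i : size (copies i) = wt i.
Proof. by rewrite size_image card_ord. Qed.

Lemma uniq_copies i : uniq (copies i).
Proof.
rewrite map_inj_uniq ?enum_uniq // => c d eq_cd.
have := eq_refl (Tagged (fun i => 'I_(wt i)) c); rewrite {2}eq_cd.
by rewrite -tag_eqE /tag_eq eqxx /= tagged_asE => /eqP.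
Qed.

Lemma card_blow : #|blow| = \sum_(i : G) wt i.
Proof.
rewrite card_tagged sumnE big_map big_enum.
by apply: eq_bigr => i _; rewrite card_ord.
Qed.

Definition btag (x : blow) : G := tag x.
Definition bedge (e : blow * blow) : G * G := (tag e.1, tag e.2).

Lemma ends_bedge p : ends (map bedge p) = map btag (ends p).
Proof. by rewrite /ends /unzip1 /unzip2 map_cat -!map_comp. Qed.

Lemma fits_btag (s : seq blow) : fits s -> fits (map btag s).
Proof.
rewrite fits_uniq // => us; apply/fitsP=> i; rewrite count_map -size_filter -size_copies.
apply: uniq_leq_size; first exact: filter_uniq.
by move=> x; rewrite mem_filter mem_copies => /andP[].
Qed.

(** Occurrences within the weights can be sent to distinct copies. *)
Lemma fits_lift (s : seq G) : fits s -> exists2 s', uniq s' & map btag s' = s.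
Proof.
elim: s => [|i s IH] f; first by exists [::].
have [|s' us' def_s] := IH; first exact: (@fits_catr _ [:: i]).
have [x xi xs'] : exists2 x, x \in copies i & x \notin s'.
  apply/hasP; apply: contraLR f => /hasPn sub; apply/negP=> /fitsP/(_ i).
  rewrite /= eqxx add1n ltnNge -def_s count_map -size_filter -size_copies.
  rewrite uniq_leq_size ?uniq_copies // => x xi.
  by have := sub x xi; rewrite negbK mem_filter /= -mem_copies xi.
exists (x :: s'); rewrite /= ?xs' //; rewrite mem_copies in xi.
by rewrite def_s; congr (_ :: _); apply/eqP.
Qed.

Lemma lift_packing (q : seq G) (p : seq (G * G)) :
  fits (q ++ ends p) ->
  exists q' p', [/\ fits (q' ++ ends p'), map btag q' = q & map bedge p' = p].
Proof.
case/fits_lift=> s us def_s.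
pose q' := take (size q) s; pose r := drop (size q) s.
have def_q : map btag q' = q by rewrite map_take def_s take_size_cat.
have def_r : map btag r = ends p by rewrite map_drop def_s drop_size_cat.
pose a := take (size p) r; pose b := drop (size p) r.
have def_a : map btag a = unzip1 p.
  by rewrite map_take def_r take_size_cat // size_map.
have def_b : map btag b = unzip2 p.
  by rewrite map_drop def_r drop_size_cat // size_map.
have sza : size a = size p by rewrite -(size_map btag) def_a size_map.
have szb : size b = size p by rewrite -(size_map btag) def_b size_map.
exists q', (zip a b); split=> //.
  rewrite fits_uniq // /ends unzip1_zip ?unzip2_zip ?sza ?szb //.
  by rewrite !cat_take_drop.
have -> : map bedge (zip a b) = zip (map btag a) (map btag b).
  by elim: (a) (b) => [|x a' IH] [|y b'] //=; rewrite IH.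
by rewrite def_a def_b zip_unzip.
Qed.

Lemma saturating_blow t : saturating t G -> saturating t blow.
Proof.
case/saturatingE=> nu_lt pack; apply/saturatingE; split=> [p /andP[ap fp] | x].
  rewrite -(size_map bedge); apply: nu_lt.
  by rewrite /pmatch ends_bedge fits_btag // andbT all_map.
have [q [p [aq ap f le_t]]] := pack (tag x).
have [q' [p' [f' def_q def_p]]] := lift_packing f.
exists q', p'; split=> //.
- by move: aq; rewrite -def_q all_map.
- by move: ap; rewrite -def_p all_map.
by rewrite -(size_map btag) def_q -(size_map bedge) def_p.
Qed.

End BlowUp.

Lemma isolated_blow (G : wgraph) : isolated_triangle (blow G) -> isolated_triangle G.
Proof.
case=> A [sepA /triangle_vertices[a [b [c [defA us _ adjA]]]]].
have closeA (x y : blow G) : x \in A -> adj x y -> y \in A.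
  by move=> xA; apply: contraTT; apply: sepA.
have [aA bA cA] : [/\ a \in A, b \in A & c \in A] by rewrite defA !inE !eqxx ?orbT.
have nbrA (x y z : blow G) : A = [set x; y; z] -> x \in A -> forall i : G,
    adj (tag x) i -> i \in [:: tag y; tag z].
  move=> defA' xA i ai.
  pose u : blow G := Tagged (fun i => 'I_(wt i)) (Ordinal (wt_gt0 i)).
  have : u \in A by apply: closeA xA _.
  rewrite defA' !inE -orbA => /or3P[/eqP ux | /eqP<- | /eqP<-]; rewrite ?eqxx ?orbT //.
  by move: ai; rewrite -ux /= adj_irr.
have wtA (x y : blow G) : x \in A -> y \in A -> x != y -> wt (tag y) = 1.
  move=> xA yA xy.
  have : {subset copies (tag y) <= [:: y]}.
    move=> z; rewrite mem_copies inE => /eqP zy.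
    have axz : @adj (blow G) x z by move: (adjA x y xA yA xy); rewrite /= /blow_adj zy.
    have zA := closeA _ _ xA axz; case: (eqVneq z y) => // neq_zy.
    by have := adjA _ _ zA yA neq_zy; rewrite /= /blow_adj zy adj_irr.
  move/(uniq_leq_size (uniq_copies _)); rewrite size_copies => le1.
  by apply/eqP; rewrite eqn_leq le1 wt_gt0.
have [/andP[ab ac] bc] : (a != b) && (a != c) /\ b != c.
  by move: us; rewrite /= !inE negb_or => /and3P[].
have ba : b != a by rewrite eq_sym.
apply: (@isolated_triangleI G (tag a) (tag b) (tag c)).
- exact: wtA bA aA ba.
- exact: wtA aA bA ab.
- exact: wtA aA cA ac.
- exact: adjA.
- exact: adjA.
- exact: adjA.
- by apply: nbrA aA.
- by apply: nbrA bA; rewrite defA; congr (_ :|: _); apply: setUC.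
by apply: nbrA cA; rewrite defA setUC setUA.
Qed.

(** * Deleting an isolated triangle *)

(** Saturating, with a matching of size t - 1. The matching is what the vertices
    of an isolated triangle need when such a triangle is added; K5, which is
    4-saturating, has none of size 3. *)
Definition tight (t : nat) (G : wgraph) : Prop := saturating t G /\ t.-1 <= nu G.

Section Deletion.

Variables (G : wgraph) (A : {set G}).
Hypothesis sepA : forall i j, i \in A -> j \notin A -> ~~ adj i j.
Hypothesis A3 : is_complete 3 (del (~: A)).

Lemma closed_in i j : adj i j -> (i \in A) = (j \in A).
Proof.
move=> aij; apply/idP/idP => [iA | jA]; apply: contraLR aij => nA; first exact: sepA.
by rewrite adj_sym; apply: sepA.
Qed.

Lemma sum_triangle : \sum_(i in A) wt i = 3.
Proof.
have [cardA wA _] := A3.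
rewrite -cardA card_sig -sum1_card; apply: eq_big => [i|i iA].
  by rewrite !inE negbK.
by have [a [b [c [_ _ w1 _]]]] := triangle_vertices A3; apply: w1.
Qed.

Lemma sum_rest : \sum_(u : del A) wt u + 3 = \sum_(i : G) wt i.
Proof.
rewrite [RHS](bigID (mem A)) /= sum_triangle addnC; congr (_ + _).
rewrite [RHS](reindex_omap (val : del A -> G) insub) /=.
  by apply: eq_bigl => u; rewrite valK eqxx andbT; apply/esym/(valP u).
by move=> i iA; rewrite insubT.
Qed.

(** The edges of p outside of the triangle. *)
Definition rest (p : seq (G * G)) := [seq e <- p | (e.1 \notin A) && (e.2 \notin A)].

Lemma size_rest p : all (@adjp G) p -> fits (ends p) -> size p <= (size (rest p)).+1.
Proof.
move=> ap /fitsP fp.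
have : count (mem (enum A)) (ends p) <= 3.
  apply: leq_trans (count_le_sum _ _) _; rewrite -sum_triangle big_enum /=.
  exact: leq_sum.
have -> : count (mem (enum A)) (ends p) = count (mem A) (ends p).
  by apply: eq_count => i; rewrite /= mem_enum.
have : count (mem A) (ends p) + (size (rest p)).*2 = (size p).*2.
  elim: p ap {fp} => [|e p IH] // /andP[ae /IH def_p].
  rewrite count_ends_cons [size (e :: p)]/= doubleS -def_p /= -(closed_in ae).
  by case: (e.1 \in A); rewrite /= ?doubleS ?addnS ?addSn ?add0n.
move=> def_c c3; rewrite -ltnS -ltn_double -def_c.
by rewrite !doubleS -addn4 addnC ltn_add2l.
Qed.

Lemma all_rest p : all (@adjp G) p -> all (@adjp G) (rest p).
Proof. by move=> /allP ap; apply/allP=> e; rewrite mem_filter => /andP[_ /ap]. Qed.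

Lemma rest_notin p : all (fun i => i \notin A) (ends (rest p)).
Proof. by rewrite all_ends; apply/allP=> e; rewrite mem_filter => /andP[]. Qed.

Lemma fits_rest (q : seq G) p : fits (q ++ ends p) -> fits (q ++ ends (rest p)).
Proof.
move/fitsP=> f; apply/fitsP=> i; apply: leq_trans (f i).
by rewrite count_cat [X in _ <= X]count_cat leq_add2l; apply: count_ends_filter.
Qed.

(** An edge of the triangle extends each packing that avoids the triangle. *)
Lemma triangle_edge (q : seq G) p :
  all (fun i => i \notin A) (q ++ ends p) -> fits (q ++ ends p) ->
  exists2 e : G * G, adjp e & fits (q ++ ends (e :: p)).
Proof.
have [a [b [c [defA us w1 adjA]]]] := triangle_vertices A3.
move=> /allP notA /fitsP f; exists (a, b).
  apply: adjA; rewrite ?defA ?inE ?eqxx ?orbT //.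
  by move: us; rewrite /= !inE negb_or -andbA => /andP[].
apply/fitsP=> i; rewrite count_cat count_ends_cons addnCA -count_cat /=.
have [aA bA] : a \in A /\ b \in A by rewrite defA !inE !eqxx ?orbT.
have [iA | iA] := boolP (i \in A); last first.
  have ne z : z \in A -> (z == i) = false by apply: contraTF => /eqP->.
  by rewrite !ne ?add0n.
rewrite w1 // (count_memPn _) ?addn0; last first.
  by apply: contraL iA => /notA.
case: eqP us => [<-|] /=; last by case: (b == i).
by rewrite !inE negb_or -andbA => /andP[/negPf]; rewrite eq_sym => ->.
Qed.

Lemma saturating_del t : saturating t.+1 G -> saturating t (del A).
Proof.
case/saturatingE=> nu_lt pack; split.
  rewrite ltnNge; apply/negP => /nu_delP[p [/andP[ap fp] sz pA]].
  have [e ae fe] := @triangle_edge [::] p pA fp.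
  have := nu_lt (e :: p); rewrite /= sz ltnn => h.
  by suff: false by []; apply: h; rewrite /pmatch /= ae ap.
move=> u; apply/sat_atP; have [q [p [aq ap f le_t]]] := pack (val u).
have qA : all (fun i => i \notin A) q.
  by apply/allP=> x /(allP aq) /closed_in <-; apply: (valP u).
have [q' def_q] := lift_del qA.
have [p' def_p] := liftp_del (rest_notin p).
exists q', p'; split.
- by move: aq; rewrite -def_q all_map.
- by have := all_rest ap; rewrite -def_p all_map.
- by rewrite fits_val map_cat def_q -ends_val def_p fits_rest.
rewrite -(size_map val) def_q -(size_map (@valp G A)) def_p -ltnS -addnS.
by apply: leq_trans le_t _; rewrite leq_add2l size_rest ?(fits_catr f).
Qed.

Lemma tight_add t : 0 < t -> tight t (del A) -> tight t.+1 G.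
Proof.
move=> t_gt0 [[nu_lt sat] le_nu].
have [a [b [c [defA us w1 adjA]]]] := triangle_vertices A3.
have [p0 [/andP[ap0 fp0] sz0 p0A]] := (nu_delP _ _).1 le_nu.
split; last first.
  have [e ae fe] := @triangle_edge [::] p0 p0A fp0; apply/nuP; exists (e :: p0).
    by rewrite /pmatch /= ae ap0.
  by rewrite /= sz0 prednK.
apply/saturatingE; split=> [p /andP[ap fp] | x].
  rewrite ltnS; apply: leq_trans (size_rest ap fp) _.
  apply: leq_trans nu_lt; rewrite ltnS; apply/nu_delP; exists (rest p); split=> //.
    by rewrite /pmatch all_rest //= (@fits_rest [::]).
  exact: rest_notin.
have [xA | xA] := boolP (x \in A); last first.
  pose u : del A := Sub x xA.
  have [q [p [aq ap f le_t]]] := (sat_atP t u).1 (sat u).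
  have fv : fits (map val q ++ ends (map (@valp G A) p)).
    by rewrite ends_val -map_cat -fits_val.
  have [|e ae fe] := triangle_edge _ fv.
    by rewrite all_cat ends_notin andbT all_map; apply/allP=> y _; apply: (valP y).
  exists (map val q), (e :: map (@valp G A) p); split=> //=.
  - by rewrite all_map.
  - by rewrite ae all_map.
  by rewrite !size_map addnS ltnS.
exists (rem x [:: a; b; c]), p0.
have xs : x \in [:: a; b; c] by move: xA; rewrite defA !inE orbA.
have memA y : (y \in A) = (y \in [:: a; b; c]) by rewrite defA !inE orbA.
split=> //.
- apply/allP=> y; rewrite (mem_rem_uniq _ us) inE => /andP[yx ys].
  by apply: adjA; rewrite ?memA // eq_sym.
- apply/fitsP=> i; rewrite count_cat; have [iA | iA] := boolP (i \in A).
    rewrite w1 // [X in _ + X](count_memPn _) ?addn0.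
      by rewrite count_uniq_mem ?leq_b1 // rem_uniq.
    by apply: contraL iA => /(allP p0A).
  rewrite (count_memPn _) ?add0n; first exact: (fitsP _ fp0).
  by apply: contra iA => /mem_rem; rewrite memA.
by rewrite size_rem // sz0 /= addSn addSn add0n prednK.
Qed.

End Deletion.

(** * Alternating walks *)

Definition flip (T : Type) (e : T * T) : T * T := (e.2, e.1).

Section Alternating.

Variable G : wgraph.
Implicit Types (M s r p : seq (G * G)) (e g : G * G) (x y z u v : G).

(** The edge e, in one of its two orientations, belongs to M. *)
Definition either M e : bool := (e \in M) || (flip e \in M).

(** y, e1.1, e1.2, e2.1, e2.2, ..., z is a walk, for s = [:: e1; e2; ...] a list
    of edges. *)
Fixpoint altwalk y s z : bool :=
  if s is e :: s' then adj y e.1 && altwalk e.2 s' z else adj y z.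

(** The edges of the walk that are not in s. *)
Fixpoint walk_edges y s z : seq (G * G) :=
  if s is e :: s' then (y, e.1) :: walk_edges e.2 s' z else [:: (y, z)].

Lemma altwalk_edges y s z : altwalk y s z = all (@adjp G) (walk_edges y s z).
Proof. by elim: s y => [|e s IH] y /=; rewrite ?andbT // IH. Qed.

Lemma size_walk_edges y s z : size (walk_edges y s z) = (size s).+1.
Proof. by elim: s y => //= e s IH y; rewrite IH. Qed.

Lemma ends_walk_edges y s z :
  perm_eq (ends (walk_edges y s z)) (y :: z :: ends s).
Proof.
apply/permP=> a; elim: s y => [|e s IH] y; first by [].
have -> : count a (y :: z :: ends (e :: s)) = a y + (a z + count a (ends (e :: s))) by [].
rewrite [walk_edges _ _ _]/= !count_ends_cons IH /= -!addnA.
by congr (_ + _); rewrite [RHS]addnCA; congr (_ + _); apply: addnCA.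
Qed.

Lemma altwalk_cat y s1 e s2 z :
  altwalk y (s1 ++ e :: s2) z = altwalk y s1 e.1 && altwalk e.2 s2 z.
Proof. by elim: s1 y => [|g s1 IH] y //=; rewrite IH andbA. Qed.

(** The walk s traversed backwards. *)
Definition backwards s : seq (G * G) := rev (map (@flip G) s).

Lemma altwalk_backwards y s z : altwalk z (backwards s) y = altwalk y s z.
Proof.
elim: s y => [|e s IH] y /=; first exact: adj_sym.
by rewrite /backwards /= rev_cons -cats1 altwalk_cat /= IH andbC adj_sym.
Qed.

Lemma ends_backwards s : perm_eq (ends (backwards s)) (ends s).
Proof.
apply/permP=> a; rewrite /ends /unzip1 /unzip2 !count_cat /backwards !map_rev !count_rev.
by rewrite -!map_comp addnC.
Qed.

Lemma either_flip M e : either M (flip e) = either M e.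
Proof. by case: e => u v; rewrite /either orbC. Qed.

Lemma eitherC M u v : either M (u, v) = either M (v, u).
Proof. exact: (either_flip M (v, u)). Qed.

Lemma either_adj M e : all (@adjp G) M -> either M e -> adjp e.
Proof. by move=> /allP aM /orP[] /aM //; rewrite /adjp adj_sym. Qed.

Lemma either_ends M e : either M e -> (e.1 \in ends M) && (e.2 \in ends M).
Proof.
case: e => u v /orP[] eM; rewrite !mem_cat.
  by rewrite (map_f (@fst _ _) eM) (map_f (@snd _ _) eM) orbT.
by rewrite (map_f (@fst _ _) eM) (map_f (@snd _ _) eM) orbT.
Qed.

Lemma ends_either M u : u \in ends M -> exists v, either M (u, v).
Proof.
rewrite mem_cat => /orP[] /mapP[[a b] abM ->] /=; [exists b | exists a];
  by rewrite /either /flip /= abM ?orbT.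
Qed.

Lemma ends_perm M N : perm_eq M N -> perm_eq (ends M) (ends N).
Proof. by move=> pMN; rewrite /ends perm_cat // perm_map. Qed.

(** M and N have the same edges, up to orientation. *)
Definition same M N : bool := all (either M) N && perm_eq (ends N) (ends M).

(** Each edge of M can be brought to the front, in either orientation. *)
Lemma either_front M e : either M e ->
  exists r, same M (e :: r)
    /\ forall g, either M g -> g.1 != e.1 -> g.1 != e.2 -> either r g.
Proof.
move=> eM; have [h hM he] : exists2 h, h \in M & h = e \/ h = flip e.
  by case/orP: eM => hM; [exists e | exists (flip e)]; auto.
exists (rem h M); split.
  apply/andP; split; first by rewrite /= eM; apply/allP=> g /mem_rem; rewrite /either => ->.
  apply/permP=> a; rewrite (permP (ends_perm (perm_to_rem hM))) !count_ends_cons.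
  by case: he => ->; rewrite //= [a e.2 + _]addnC.
have remh k : k \in M -> k != h -> k \in rem h M.
  by move=> kM kh; move: kM; rewrite (perm_mem (perm_to_rem hM)) inE (negPf kh).
move=> [u v] gM /= g1 g2; have [uvh vuh] : (u, v) != h /\ (v, u) != h.
  by case: he => ->; case: e g1 g2 {eM} => a b /= ua ub;
     rewrite /flip /= !xpair_eqE (negPf ua) (negPf ub) ?andbF.
by rewrite /either; case/orP: gM => /remh->; rewrite ?orbT.
Qed.

(** So can several disjoint edges of M, in any order and orientations. *)
Lemma either_fronts M s :
  all (either M) s -> uniq (ends s) -> exists r, same M (s ++ r).
Proof.
elim: s M => [|e s IH] M.
  move=> _ _; exists M; rewrite /same perm_refl andbT /=.
  by apply/allP=> e eM; rewrite /either eM.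
move=> /andP[] /either_front[r [/andP[/andP[eM rM] per] front]] sM.
rewrite (perm_uniq (perm_ends_cons e s)) /= !inE negb_or => /and3P[/andP[_ e1] e2 us].
have [|r' /andP[sr pr]] := IH r _ us.
  apply/allP=> g gs; have /either_ends/andP[g1 _] : either s g by rewrite /either gs.
  apply: front; first exact: (allP sM).
    by apply: contraNneq e1 => <-.
  by apply: contraNneq e2 => <-.
exists r'; apply/andP; split; last first.
  apply: perm_trans per; apply: perm_trans (perm_ends_cons _ _) _.
  by rewrite perm_sym (permPl (perm_ends_cons _ _)) !perm_cons perm_sym.
rewrite /= eM; apply/allP=> g /(allP sr) gr.
by case/orP: gr => /(allP rM) //; rewrite either_flip.
Qed.

(** A matching with the most edges. *)
Definition maximum M : Prop := pmatch M /\ forall p, pmatch p -> size p <= size M.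

(** Berge: a walk that alternates between edges off M and disjoint edges of M,
    with two distinct uncovered ends, would give a larger matching. *)
Lemma no_augmenting M s y z :
  (forall i : G, wt i = 1) -> maximum M ->
  all (either M) s -> uniq (ends s) -> y \notin ends M -> z \notin ends M ->
  y != z -> altwalk y s z -> False.
Proof.
move=> w1 [/andP[aM fM] maxM] sM us yM zM yz walk.
have [r /andP[srM per]] := either_fronts sM us.
rewrite fits_uniq // in fM.
have := maxM (walk_edges y s z ++ r).
have szM : size M = size s + size r.
  by apply: double_inj; rewrite -size_cat -!size_ends (perm_size per).
rewrite size_cat size_walk_edges szM addSn ltnn => h; suff: false by [].
apply: h; apply/andP; split.
  rewrite all_cat -altwalk_edges walk /=; apply/allP=> e er.
  by apply: (either_adj aM); apply: (allP srM); rewrite mem_cat er orbT.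
rewrite fits_uniq // (perm_uniq (perm_ends_cat _ _)).
rewrite (perm_uniq (perm_cat (ends_walk_edges _ _ _) (perm_refl _))) /=.
have {}per : perm_eq (ends s ++ ends r) (ends M).
  by rewrite -(permPl (perm_ends_cat _ _)).
by rewrite inE negb_or yz !(perm_mem per) yM zM (perm_uniq per).
Qed.

(** If an end of an edge of M is not on another edge of M, nor is the other
    end. *)
Lemma either_partner M e g : uniq (ends M) -> either M e -> either M g ->
  e.1 != g.1 -> e.1 != g.2 -> (e.2 != g.1) && (e.2 != g.2).
Proof.
move=> uM eM gM n1 n2; have [r [/andP[_ per] front]] := either_front gM.
have /either_ends/andP[_ e2r] := front e eM n1 n2.
move: uM; rewrite -(perm_uniq per) (perm_uniq (perm_ends_cons _ _)) /= inE negb_or.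
case/and3P=> /andP[_ g1] g2 _.
by apply/andP; split; apply: contraTneq e2r => ->.
Qed.

(** * Blossoms *)

(** An odd closed walk x, e1.1, e1.2, ..., x with disjoint edges e1, ..., of M,
    from a vertex x that M does not cover. *)
Definition blossom M x s : bool :=
  [&& ~~ nilp s, all (either M) s, uniq (ends s) & altwalk x s x].

Section Maximum.

Variable M : seq (G * G).
Hypotheses (w1 : forall i : G, wt i = 1) (maxM : maximum M).

Lemma uniqM : uniq (ends M).
Proof. by have [/andP[_ fM] _] := maxM; rewrite fits_uniq in fM. Qed.

Lemma adjM e : either M e -> adjp e.
Proof. by have [/andP[aM _] _] := maxM; apply: either_adj. Qed.

(** No other uncovered vertex is adjacent to a blossom: half of the blossom, run
    in the suitable direction, would complete an augmenting walk. *)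
Lemma blossom_exclusive x s y e : blossom M x s ->
  x \notin ends M -> y \notin ends M -> y != x -> e \in s ->
  ~~ adj y e.1 && ~~ adj y e.2.
Proof.
case/and4P=> _ sM us walk xM yM yx es.
have half s' (e' : G * G) : all (either M) s' -> uniq (ends s') ->
    altwalk x s' x -> e' \in s' -> ~~ adj y e'.1.
  move=> sM' us' walk' /path.splitPr def_s; case: s' / def_s sM' us' walk' => s1 s2.
  rewrite altwalk_cat all_cat (perm_uniq (perm_ends_cat _ _)) cat_uniq.
  case/andP=> _ s2M /and3P[_ _ us2] /andP[_ walk2]; apply/negP=> ye.
  by apply: (no_augmenting w1 maxM s2M us2 yM xM yx); rewrite /= ye.
rewrite (half s e) //=; apply: (half (backwards s) (flip e)).
- by rewrite all_rev all_map; apply: sub_all sM => g; rewrite /= either_flip.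
- by rewrite (perm_uniq (ends_backwards s)).
- by rewrite altwalk_backwards.
by rewrite mem_rev map_f.
Qed.

(** The edge of M next to y in a blossom of y avoids each blossom of x. *)
Lemma blossom_head_disjoint x s y e : blossom M x s ->
  x \notin ends M -> y \notin ends M -> y != x -> either M e -> adj y e.1 ->
  (e.1 \notin ends s) && (e.2 \notin ends s).
Proof.
move=> bs xM yM yx eM ye1.
have sM : all (either M) s by case/and4P: bs.
have ne g : g \in s -> (e.1 != g.1) && (e.1 != g.2).
  move=> gs; have /andP[n1 n2] := blossom_exclusive bs xM yM yx gs.
  by apply/andP; split; apply: contraTneq ye1 => ->.
have out u : (forall g, g \in s -> (u != g.1) && (u != g.2)) -> u \notin ends s.
  move=> nu; rewrite mem_cat negb_or; apply/andP; split; apply/mapP=> -[g gs def_u].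
    by have := nu g gs; rewrite -def_u eqxx.
  by have := nu g gs; rewrite -def_u eqxx andbF.
rewrite !out // => g gs; have /andP[n1 n2] := ne g gs.
by apply: (either_partner uniqM) => //; apply: (allP sM).
Qed.

Lemma size_disjoint s : all (either M) s -> uniq (ends s) -> size s <= size M.
Proof.
move=> sM us; rewrite -leq_double -!size_ends; apply: uniq_leq_size => // u.
by rewrite mem_cat => /orP[] /mapP[e es ->]; have /either_ends/andP[] := allP sM e es.
Qed.


Lemma wdeg_card x : wdeg x = #|nbh x|.
Proof. by rewrite /wdeg -sum1_card; apply: eq_bigr => i _; apply: w1. Qed.

Section Existence.

Hypothesis sat : saturating 4 G.
Variable x : G.
Hypothesis xM : x \notin ends M.

Lemma size_maximum : size M <= 3.
Proof. by have [mM _] := maxM; have [nu_lt _] := (saturatingE _ _).1 sat; apply: nu_lt. Qed.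

Lemma nbr_covered j : adj x j -> j \in ends M.
Proof.
move=> xj; apply: contraT => jM.
case: (@no_augmenting M [::] x j w1 maxM isT isT xM jM _ xj).
by apply: contraTneq xj => <-; rewrite adj_irr.
Qed.

Hypothesis no_triangle : forall e, either M e -> ~~ (adj x e.1 && adj x e.2).

(** The edges of M that contain a neighbour of x, and the other ones. *)
Let near : pred (G * G) := [pred e | adj x e.1 || adj x e.2].
Let far := [seq e <- M | ~~ near e].

Lemma card_near : #|nbh x| <= size [seq e <- M | near e].
Proof.
rewrite cardE -(size_map (fun e => if adj x e.1 then e.1 else e.2)).
apply: uniq_leq_size; first exact: enum_uniq.
move=> j; rewrite mem_enum inE => xj.
have [v jv] := ends_either (nbr_covered xj); have := no_triangle jv.
rewrite /= xj /= => xv; apply/mapP.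
case/orP: jv => jvM.
  by exists (j, v); rewrite ?mem_filter /near /= xj.
by exists (v, j); rewrite ?mem_filter /near /= ?(negPf xv) ?xj ?eM.
Qed.

Lemma not_nbr z : ~~ adj x z -> z \notin ends far ->
  z \notin ends M \/ exists2 a, either M (a, z) & adj x a.
Proof.
move=> xz zf; have [zM | ?] := boolP (z \in ends M); last by left.
have [v zv] := ends_either zM; have [xv | xv] := boolP (adj x v).
  by right; exists v; rewrite // eitherC.
case/negP: zf; case/orP: zv => zv; rewrite /ends mem_cat.
  by rewrite (map_f fst (_ : (z, v) \in far)) // mem_filter /near /= negb_or xz xv.
by rewrite orbC (map_f snd (_ : (v, z) \in far)) // mem_filter /near /= negb_or xz xv.
Qed.

Lemma partner_neq a b u v : either M (a, u) -> either M (b, v) ->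
  adj x a -> adj x b -> ~~ adj x u -> ~~ adj x v -> u != v ->
  [/\ a != b, a != u, a != v, b != u & b != v].
Proof.
move=> au bv xa xb xu xv uv.
have ne c w : adj x c -> ~~ adj x w -> c != w by move=> xc; apply: contraNneq => <-.
suff ab : a != b by split=> //; apply: ne.
have ua : either M (u, a) by rewrite eitherC.
have vb : either M (v, b) by rewrite eitherC.
have ub : u != b by rewrite eq_sym ne.
by have /andP[] := either_partner uniqM ua vb uv ub.
Qed.

Lemma blossomI s : ~~ nilp s -> all (either M) s -> uniq (ends s) -> altwalk x s x ->
  exists s, blossom M x s.
Proof. by move=> *; exists s; apply/and4P. Qed.

(** Vacuous: M cannot be augmented. *)
Lemma augmentF s y z : all (either M) s -> uniq (ends s) -> y \notin ends M ->
  z \notin ends M -> y != z -> altwalk y s z -> exists s, blossom M x s.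
Proof. by move=> *; case: (@no_augmenting M s y z). Qed.

Lemma adj_neq u v : @adj G u v -> u != v.
Proof. by apply: contraTneq => ->; rewrite adj_irr. Qed.

Lemma nbr_neq a u : adj x a -> ~~ adj x u -> a != u.
Proof. by move=> xa; apply: contraNneq => <-. Qed.

Lemma single_blossom u v a : adj u v -> ~~ adj x u -> ~~ adj x v ->
  u \notin ends M -> either M (a, v) -> adj x a -> exists s, blossom M x s.
Proof.
move=> uv xu xv uM av xa; apply: (@augmentF [:: (v, a)] u x) => //=.
- by rewrite eitherC av.
- by rewrite inE andbT eq_sym nbr_neq.
- by apply: contraTneq uv => ->.
by rewrite uv adj_sym xa.
Qed.

(** The vertices u and v are uncovered or partners of neighbours of x. If both
    are partners then x, a, u, v, b is a blossom; else M would grow. *)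
Lemma short_blossom u v : adj u v -> ~~ adj x u -> ~~ adj x v ->
  u \notin ends far -> v \notin ends far -> exists s, blossom M x s.
Proof.
move=> uv xu xv uf vf; have vu : adj v u by rewrite adj_sym.
case: (not_nbr xu uf) (not_nbr xv vf) => [uM | [a au xa]] [vM | [b bv xb]].
- by apply: (@augmentF [::] u v) => //; apply: adj_neq.
- exact: single_blossom uv xu xv uM bv xb.
- exact: single_blossom vu xv xu vM au xa.
have [ab a_u a_v b_u b_v] := partner_neq au bv xa xb xu xv (adj_neq uv).
apply: (@blossomI [:: (a, u); (v, b)]) => //=.
- by rewrite au eitherC bv.
- rewrite !inE !negb_or a_v a_u ab /= (eq_sym v) (adj_neq uv) (eq_sym v) b_v.
  by rewrite (eq_sym u) b_u.
by rewrite xa uv adj_sym xb.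
Qed.

(** The same for two edges off M that are joined by the edge (g1, g2) of M; the
    blossom has seven vertices. *)
Lemma long_blossom (g1 q1 g2 q2 : G) : uniq [:: g1; q1; g2; q2] ->
  ~~ adj x g1 -> ~~ adj x q1 -> ~~ adj x g2 -> ~~ adj x q2 ->
  adj g1 q1 -> adj g2 q2 -> either M (g1, g2) ->
  q1 \notin ends far -> q2 \notin ends far -> exists s, blossom M x s.
Proof.
have half (h1 r1 h2 r2 a : G) : uniq [:: h1; r1; h2; r2] ->
    ~~ adj x h1 -> ~~ adj x r1 -> ~~ adj x h2 -> ~~ adj x r2 ->
    adj h1 r1 -> adj h2 r2 -> either M (h1, h2) -> r1 \notin ends M ->
    either M (a, r2) -> adj x a -> exists s, blossom M x s.
  rewrite /= !inE !negb_or => /and4P[/and3P[hr1 h12 h1r2] /andP[r1h2 r12] hr2 _].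
  move=> xh1 xr1 xh2 xr2 hr hr' hM rM aM xa.
  apply: (@augmentF [:: (h1, h2); (r2, a)] r1 x) => //=.
  - by rewrite hM eitherC aM.
  - by rewrite !inE !negb_or h1r2 h12 ![_ == a]eq_sym (eq_sym r2) hr2 !nbr_neq.
  - by apply: contraNneq xh1 => <-; rewrite adj_sym.
  by rewrite adj_sym hr hr' adj_sym xa.
move=> ug xg1 xq1 xg2 xq2 gq1 gq2 gM f1 f2.
have ug' : uniq [:: g2; q2; g1; q1] by have := ug; rewrite -(rot_uniq 2).
move: ug; rewrite /= !inE !negb_or => /and4P[/and3P[gq1' g12 g1q2] /andP[q1g2 q12] gq2' _].
case: (not_nbr xq1 f1) (not_nbr xq2 f2) => [qM1 | [a aq xa]] [qM2 | [b bq xb]].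
- apply: (@augmentF [:: (g1, g2)] q1 q2) => //=; rewrite ?gM ?inE ?g12 //.
  by rewrite adj_sym gq1 gq2.
- apply: (half g1 q1 g2 q2 b) => //.
  by rewrite /= !inE !negb_or gq1' g12 g1q2 q1g2 q12 gq2'.
- by apply: (half g2 q2 g1 q1 a); rewrite // eitherC.
have [ab a1 a2 b1 b2] := partner_neq aq bq xa xb xq1 xq2 q12.
apply: (@blossomI [:: (a, q1); (g1, g2); (q2, b)]) => //=.
- by rewrite aq gM eitherC bq.
- rewrite !inE !negb_or a1 a2 ab g1q2 gq1' g12 q1g2 (eq_sym q2 q1) q12.
  by rewrite (eq_sym q2 g2) gq2' ![_ == b]eq_sym b1 b2 !nbr_neq.
by rewrite xa adj_sym gq1 gq2 adj_sym xb.
Qed.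

Lemma far_blossom : exists s, blossom M x s.
Proof.
have [nu_lt sat_v] := sat; have [aM maxM'] := maxM.
have [p [mp szp px]] := (nu_delP _ _).1 (sat_v x).
have [/allP ap fp] := andP mp; rewrite fits_uniq // in fp.
have avoid u : u \in ends p -> ~~ adj x u by move/(allP px); rewrite inE.
have endsp e : e \in p -> [/\ adj e.1 e.2, e.1 \in ends p & e.2 \in ends p].
  by move=> ep; split; [exact: ap | |]; rewrite mem_cat map_f ?orbT.
have szM := size_maximum.
have le_p := maxM' p mp.
have le_near : wdeg x <= size [seq e <- M | near e] by rewrite wdeg_card card_near.
have def_M : size [seq e <- M | near e] + size far = size M.
  by rewrite /far !size_filter count_predC.
have short e : e \in p -> e.1 \notin ends far -> e.2 \notin ends far ->
    exists s, blossom M x s.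
  by move=> /endsp[e12 /avoid x1 /avoid x2]; apply: short_blossom.
(* The neighbours of x are at most the near edges, so p has more edges than far. *)
have lt_far : size far < size p.
  rewrite szp ltn_subRL addnC.
  apply: leq_ltn_trans (leq_add (leqnn _) le_near) _; rewrite addnC def_M.
  by rewrite ltnS.
case def_far: far lt_far => [|c [|c' far']] lt_p.
- case def_p: p lt_p => [|e p'] // _.
  have ep : e \in p by rewrite def_p mem_head.
  by apply: short ep _ _; rewrite def_far.
- case def_p: p lt_p => [|e1 [|e2 p']] // _.
  have [ep1 ep2] : e1 \in p /\ e2 \in p by rewrite def_p !inE !eqxx orbT.
  have cM : either M (c.1, c.2).
    have : c \in far by rewrite def_far mem_head.
    by rewrite mem_filter /either -surjective_pairing => /andP[_ ->].
  have farE u : (u \in ends far) = (u == c.1) || (u == c.2).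
    by rewrite def_far mem_ends_cons orbF.
  (* Each edge e of p has an end g in c, or a short blossom exists. *)
  have orient e : e \in p -> (exists s, blossom M x s) \/
      exists g q : G, [/\ adj g q, perm_eq [:: g; q] [:: e.1; e.2] & g \in ends far].
    move=> ep; have [e12 _ _] := endsp e ep.
    have [f1 | f1] := boolP (e.1 \in ends far).
      by right; exists e.1, e.2; rewrite perm_refl.
    have [f2 | f2] := boolP (e.2 \in ends far); last by left; apply: short ep _ _.
    right; exists e.2, e.1; split; rewrite // 1?adj_sym //.
    by rewrite -[[:: e.2; e.1]]/([:: e.2] ++ [:: e.1]) perm_catC.
  case: (orient e1 ep1) => [// | [g1 [q1 [gq1 p1 f1]]]].
  case: (orient e2 ep2) => [// | [g2 [q2 [gq2 p2 f2]]]].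
  have ug : uniq [:: g1; q1; g2; q2].
    rewrite -[[:: _; _; _; _]]/([:: g1; q1] ++ [:: g2; q2]) (perm_uniq (perm_cat p1 p2)).
    have : uniq (ends (e1 :: e2 :: p')) by rewrite -def_p.
    rewrite (perm_uniq (perm_ends_cat [:: e1; e2] p')) cat_uniq => /andP[+ _].
    by rewrite (perm_uniq (perm_ends_cons e1 [:: e2])).
  have inp u e (g q : G) : e \in p -> perm_eq [:: g; q] [:: e.1; e.2] ->
      u \in [:: g; q] -> ~~ adj x u.
    move=> /endsp[_ x1 x2] /perm_mem -> ; rewrite !inE.
    by case/orP=> /eqP->; apply: avoid.
  move: (ug); rewrite /= !inE !negb_or => /and4P[/and3P[n1 n2 n3] /andP[n4 n5] n6 _].
  have gM : either M (g1, g2) /\ ends far =i [:: g1; g2].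
    move: f1 f2; rewrite !farE => /orP[] /eqP d1 /orP[] /eqP d2;
      move: n2; rewrite d1 d2 ?eqxx // => _; split;
      first [exact: cM | by rewrite eitherC | by move=> u; rewrite farE !inE
            | by move=> u; rewrite farE !inE orbC].
  case: gM => gM eqf; apply: (long_blossom ug) => //.
  - by apply: inp ep1 p1 _; rewrite mem_head.
  - by apply: inp ep1 p1 _; rewrite !inE eqxx orbT.
  - by apply: inp ep2 p2 _; rewrite mem_head.
  - by apply: inp ep2 p2 _; rewrite !inE eqxx orbT.
  - by rewrite eqf !inE negb_or eq_sym n1.
  by rewrite eqf !inE negb_or eq_sym n3 eq_sym n6.
(* With two far edges, p has three edges; together with an edge from x to one of
   its neighbours it would exceed M. *)
have lt3 : 2 < size p by move: lt_p => /= /(leq_trans _) -> //.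
have : 0 < wdeg x.
  rewrite lt0n; apply: contraTneq (leq_trans le_p szM) => d0.
  by rewrite szp d0.
rewrite wdeg_card => /card_gt0P[j]; rewrite inE => xj.
have xp : x \notin ends p.
  apply/negP; rewrite mem_cat => /orP[] /mapP[e /endsp[e12 e1 e2] def_x].
    by have := avoid _ e2; rewrite def_x e12.
  by have := avoid _ e1; rewrite def_x adj_sym e12.
have jp : j \notin ends p by apply: contraL xj => /avoid.
have := maxM' ((x, j) :: p); rewrite /= => /(_ _)/leq_trans/(_ szM).
rewrite ltnS leqNgt lt3 => h; suff: false by []; apply: h.
apply/andP; split; first by rewrite /= /adjp xj; apply/allP.
rewrite fits_uniq // (perm_uniq (perm_ends_cons _ _)) /= inE negb_or xp jp fp.
by rewrite (adj_neq xj).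
Qed.

End Existence.

(** Under the condition at x, an uncovered vertex x is on a blossom. *)
Lemma blossom_exists x : saturating 4 G -> x \notin ends M ->
  exists s, blossom M x s.
Proof.
move=> sat xM; have [/hasP[e eM /andP[x1 x2]] | /hasPn noT] :=
    boolP (has (fun e => adj x e.1 && adj x e.2) M).
  have eM' : either M e by rewrite /either eM.
  exists [:: e]; apply/and4P; split; rewrite /= ?eM' //.
    by rewrite inE (adj_neq (adjM eM')).
  by rewrite x1 adj_sym.
apply: far_blossom => // e /orP[/noT // | /noT]; by rewrite andbC.
Qed.

End Maximum.

End Alternating.

(** * Frames of a simple graph *)

(** The cases that occur: a maximum matching 01, 23, 45 with a blossom at each
    of the uncovered vertices 6, 7, ... For one uncovered vertex the blossom is
    a triangle, a pentagon or a heptagon, for two there are two triangles or a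
    pentagon and a triangle, for three there are three triangles. *)
Definition frames : seq (seq nat * seq edge) :=
  let M := [:: (0, 1); (2, 3); (4, 5)] in
  [:: (ones 7, M ++ [:: (6, 0); (1, 6)]);
      (ones 7, M ++ [:: (6, 0); (1, 2); (3, 6)]);
      (ones 7, M ++ [:: (6, 0); (1, 2); (3, 4); (5, 6)]);
      (ones 8, M ++ [:: (6, 0); (1, 6); (7, 2); (3, 7)]);
      (ones 8, M ++ [:: (6, 0); (1, 2); (3, 6); (7, 4); (5, 7)]);
      (ones 9, M ++ [:: (6, 0); (1, 6); (7, 2); (3, 7); (8, 4); (5, 8)])].

Section Frames.

Variable G : wgraph.
Hypotheses (w1 : forall i : G, wt i = 1) (sat : saturating 4 G).

Lemma labelling_nth x0 (vs : seq G) :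
  uniq vs -> size vs = #|G| -> labelling (ones (size vs)) (nth x0 vs).
Proof.
move=> us sz; rewrite /labelling /ones size_nseq.
have all_vs x : x \in vs.
  have [|_ ->] := uniq_min_size us (fun y _ => mem_enum G y); last exact: mem_enum.
  by rewrite -cardE sz.
split=> [i j | x | i lt_i]; last by rewrite nth_nseq lt_i w1.
  by rewrite !inE => lt_i lt_j /eqP; rewrite nth_uniq // => /eqP.
by exists (index x vs); rewrite ?index_mem ?nth_index.
Qed.

Lemma maximum_exists : exists M : seq (G * G), maximum M.
Proof.
have [M mM szM] := (nuP G (nu G)).1 (leqnn _); exists M; split=> // p mp.
by rewrite szM; apply/nuP; exists p.
Qed.

Section Blossoms.

Variable M : seq (G * G).
Hypothesis maxM : maximum M.

Definition disjoint_ends (s s' : seq (G * G)) : bool :=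
  ~~ has (mem (ends s)) (ends s').

Lemma uniq_ends_cat s s' : uniq (ends s) -> uniq (ends s') -> disjoint_ends s s' ->
  uniq (ends (s ++ s')).
Proof. by move=> us us' d; rewrite (perm_uniq (perm_ends_cat _ _)) cat_uniq us us' andbT. Qed.

Lemma disjoint_ends_cat s s' s'' :
  disjoint_ends s s'' -> disjoint_ends s' s'' -> disjoint_ends (s ++ s') s''.
Proof.
move=> /hasPn d /hasPn d'; apply/hasPn=> u us.
by rewrite /= (perm_mem (perm_ends_cat _ _)) mem_cat negb_or; apply/andP; split;
  [apply: d | apply: d'].
Qed.

Lemma disjoint_endsC s s' : disjoint_ends s s' = disjoint_ends s' s.
Proof. by rewrite /disjoint_ends has_sym. Qed.

(** Blossoms at different vertices are disjoint. *)
Lemma blossoms_disjoint x y s s' : blossom M x s -> blossom M y s' ->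
  x \notin ends M -> y \notin ends M -> y != x -> disjoint_ends s s'.
Proof.
have head u v r r' : blossom M u r -> blossom M v r' ->
    u \notin ends M -> v \notin ends M -> v != u ->
    exists e r'', [/\ r' = e :: r'', e.1 \notin ends r & e.2 \notin ends r].
  move=> br /and4P[nr' aM _ walk] uM vM vu; case: r' nr' aM walk => [|e r''] // _.
  move=> /andP[eM _] /andP[ve _]; exists e, r''.
  by have /andP[] := blossom_head_disjoint w1 maxM br uM vM vu eM ve.
have szM := size_maximum maxM sat.
have lt3 u v r r' : blossom M u r -> blossom M v r' ->
    u \notin ends M -> v \notin ends M -> v != u -> size r < 3.
  move=> br br' uM vM vu; have [e [r'' [def_r' e1 e2]]] := head _ _ _ _ br br' uM vM vu.
  have [/and4P[_ rM ur _] /and4P[_ rM' ur' _]] := (br, br').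
  apply: leq_trans szM; rewrite -(size_rcons r e); apply: size_disjoint.
    by rewrite all_rcons rM andbT; move: rM'; rewrite def_r' => /andP[].
  rewrite -cats1; apply: uniq_ends_cat => //.
    rewrite (perm_uniq (perm_ends_cons e [::])) /= inE andbT.
    move: ur'; rewrite def_r' (perm_uniq (perm_ends_cons e r'')) /= inE negb_or.
    by case/and3P=> /andP[].
  by apply/hasPn => w; rewrite mem_ends_cons orbF => /orP[]/eqP->.
move=> bs bs' xM yM yx; have xy : x != y by rewrite eq_sym.
have lt_s' := lt3 _ _ _ _ bs' bs yM xM xy.
have [e [r [def_s' e1 e2]]] := head _ _ _ _ bs bs' xM yM yx.
have bs'b : blossom M y (backwards s').
  have /and4P[ns' sM' us' walk'] := bs'; apply/and4P; split.
  - by move: ns'; rewrite /nilp size_rev size_map.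
  - by rewrite all_rev all_map; apply: sub_all sM' => g; rewrite /= either_flip.
  - by rewrite (perm_uniq (ends_backwards s')).
  by rewrite altwalk_backwards.
have [g [r' [def_b g1 g2]]] := head _ _ _ _ bs bs'b xM yM yx.
move: def_b lt_s'; rewrite def_s'; case: r def_s' => [|h [|]] // def_s'.
  move=> _ _; apply/hasPn => w; by rewrite mem_ends_cons orbF => /orP[]/eqP->.
rewrite /backwards /rev /= => -[def_g _] _; apply/hasPn => w.
rewrite !mem_ends_cons orbF; move: g1 g2; rewrite -def_g /= => h2 h1.
by case/or4P=> /eqP->.
Qed.

End Blossoms.

Lemma frame_exists : 7 <= #|G| ->
  exists2 T, T \in frames & exists f : nat -> G, labelling T.1 f /\ below f T.2.
Proof.
move=> n7; have [M maxM] := maximum_exists.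
have uM := uniqM w1 maxM; have szM := size_maximum maxM sat.
have /andP[aM _] : pmatch M by case: maxM.
pose I := [seq x <- enum G | x \notin ends M].
have uI : uniq I by rewrite filter_uniq ?enum_uniq.
have cardG : #|G| = (size M).*2 + size I.
  rewrite cardE -(count_predC (mem (ends M)) (enum G)) /I size_filter; congr (_ + _).
  rewrite -size_ends -(card_uniqP uM) cardE -size_filter; congr (size _).
  by rewrite {2}/enum_mem -enumT; apply: eq_filter.
have IM x : x \in I -> x \notin ends M by rewrite mem_filter => /andP[].
have exB x : x \in I -> exists s, blossom M x s.
  by move=> /IM; apply: (blossom_exists w1 maxM).
have dis x y s s' : blossom M x s -> blossom M y s' -> x \in I -> y \in I -> y != x ->
    disjoint_ends s s'.
  by move=> bs bs' /IM xM /IM yM; apply: (blossoms_disjoint maxM bs bs').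
have pos x s : blossom M x s -> 0 < size s by rewrite lt0n => /and4P[].
(* The vertices of three disjoint edges of M, then those of I, number G. *)
have frame s xs w E : all (either M) s -> uniq (ends s) -> perm_eq xs I ->
    size M = 3 -> w = ones (6 + size xs) ->
    (forall e1 e2 e3 r, [:: e1; e2; e3] = s ++ r ->
       adjp e1 -> adjp e2 -> adjp e3 ->
       below (nth e1.1 ([:: e1.1; e1.2; e2.1; e2.2; e3.1; e3.2] ++ xs)) E) ->
    exists f : nat -> G, labelling w f /\ below f E.
  move=> sM us pxs M3 -> low; have [r /andP[rM per]] := either_fronts sM us.
  have sz : size (s ++ r) = 3.
    by apply: double_inj; rewrite -size_ends (perm_size per) size_ends M3.
  case def_N: (s ++ r) sz => [|e1 [|e2 [|e3 []]]] // _.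
  set vs := [:: e1.1; e1.2; e2.1; e2.2; e3.1; e3.2] ++ xs in low.
  have pvs : perm_eq vs (ends M ++ I).
    apply: perm_cat => //; apply: perm_trans per; rewrite def_N perm_sym.
    by apply/permP=> a; rewrite !count_ends_cons /= !addnA !addn0.
  exists (nth e1.1 vs); split.
    have -> : 6 + size xs = size vs by [].
    apply: labelling_nth; last by rewrite (perm_size pvs) size_cat size_ends cardG.
    rewrite (perm_uniq pvs) cat_uniq uM uI andbT; apply/hasPn=> x; exact: IM.
  move: rM; rewrite def_N /= => /and4P[m1 m2 m3 _].
  by apply: (low _ _ _ r (esym def_N)); apply: (either_adj aM).
have all1 s1 s2 : all (either M) s1 -> all (either M) s2 -> all (either M) (s1 ++ s2).
  by rewrite all_cat => -> ->.
have two x y : x \in I -> y \in I -> y != x -> exists s s',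
    [/\ blossom M x s, blossom M y s', all (either M) (s ++ s') & uniq (ends (s ++ s'))].
  move=> xI yI yx; have [[s bs] [s' bs']] := (exB x xI, exB y yI).
  have [/and4P[_ sM us _] /and4P[_ sM' us' _]] := (bs, bs'); exists s, s'; split=> //.
    exact: all1.
  by apply: uniq_ends_cat => //; apply: dis bs bs' _ _ _.
have three x y z : uniq [:: x; y; z] -> {subset [:: x; y; z] <= I} -> exists s s' s'',
    [/\ blossom M x s, blossom M y s', blossom M z s'',
        all (either M) (s ++ s' ++ s'') & uniq (ends (s ++ s' ++ s''))].
  rewrite /= !inE negb_or => /and3P[/andP[xy xz] yz _] sub.
  have [xI yI zI] : [/\ x \in I, y \in I & z \in I].
    by split; apply: sub; rewrite !inE eqxx ?orbT.
  have [s bs] := exB x xI; rewrite eq_sym in xy; rewrite eq_sym in xz; rewrite eq_sym in yz.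
  have [s' [s'' [bs' bs'' sM' us']]] := two y z yI zI yz.
  have /and4P[_ sM us _] := bs; exists s, s', s''; split=> //; first exact: all1.
  apply: uniq_ends_cat => //; rewrite disjoint_endsC.
  by apply: disjoint_ends_cat; rewrite disjoint_endsC;
     [apply: dis bs bs' _ _ _ | apply: dis bs bs'' _ _ _].
have le_M s : all (either M) s -> uniq (ends s) -> size s <= size M.
  exact: size_disjoint.
have le6 : (size M).*2 <= 6 by rewrite -[6]/(3.*2) leq_double.
have M3 : size I <= 2 -> size M = 3.
  move=> I2; apply/eqP; rewrite eqn_leq szM ltnNge; apply: contraL n7 => M2.
  rewrite -ltnNge ltnS cardG -[6]/(2.*2 + 2); apply: leq_add => //.
  by rewrite leq_double.
have pair x y s s' : blossom M x s -> blossom M y s' -> all (either M) (s ++ s') ->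
    uniq (ends (s ++ s')) -> perm_eq [:: x; y] I -> size s' = 1 -> size s <= 2 ->
    exists2 T, T \in frames & exists f : nat -> G, labelling T.1 f /\ below f T.2.
  move=> bs /and4P[_ _ _ walk'] sM us pI sz' le2.
  have M3' : size M = 3 by apply: M3; rewrite -(perm_size pI).
  case: s' sz' walk' sM us => [|k []] // _ /= /andP[k1 k2].
  have p0 := pos _ _ bs; move: p0 bs; case: s le2 => [|g [|h []]] // _ _ /and4P[_ _ _ /=].
    case/andP=> g1 g2 sM us; exists (nth (ones 0, [::]) frames 3); first by [].
    apply: (frame [:: g; k] _ _ _ sM us pI M3') =>
    // e1 e2 e3 r [-> -> _]; rewrite /adjp => a1 a2 a3.
    by rewrite /below /= a1 a2 a3 g1 g2 k1 k2.
  case/and3P=> g1 gh g2 sM us; exists (nth (ones 0, [::]) frames 4); first by [].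
  apply: (frame [:: g; h; k] _ _ _ sM us pI M3') =>
    // e1 e2 e3 r [-> -> -> _]; rewrite /adjp => a1 a2 a3.
  by rewrite /below /= a1 a2 a3 g1 gh g2 k1 k2.
case def_I: {1}I (perm_refl I) => [|x [|y [|z I']]] pI.
- by move: n7; rewrite cardG -(perm_size pI) addn0 leqNgt ltnS le6.
- have xI : x \in I by rewrite def_I mem_head.
  have M3' : size M = 3 by apply: M3; rewrite -(perm_size pI).
  have [s bs] := exB x xI; have /and4P[_ sM us walk] := bs.
  have le3 := le_M s sM us; rewrite M3' in le3.
  have p0 := pos _ _ bs; move: p0 le3 sM us walk {bs}; case: s => [|g [|h [|k []]]] // _ _ sM us /=.
  + case/andP=> g1 g2; exists (nth (ones 0, [::]) frames 0); first by [].
    apply: (frame [:: g] _ _ _ sM us pI M3') =>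
    // e1 e2 e3 r [-> _]; rewrite /adjp => a1 a2 a3.
    by rewrite /below /= a1 a2 a3 g1 g2.
  + case/and3P=> g1 gh g2; exists (nth (ones 0, [::]) frames 1); first by [].
    apply: (frame [:: g; h] _ _ _ sM us pI M3') =>
    // e1 e2 e3 r [-> -> _]; rewrite /adjp => a1 a2 a3.
    by rewrite /below /= a1 a2 a3 g1 gh g2.
  case/and4P=> g1 gh hk g2; exists (nth (ones 0, [::]) frames 2); first by [].
  apply: (frame [:: g; h; k] _ _ _ sM us pI M3') =>
    // e1 e2 e3 r [-> -> -> _]; rewrite /adjp => a1 a2 a3.
  by rewrite /below /= a1 a2 a3 g1 gh hk g2.
- have [xI yI] : x \in I /\ y \in I by rewrite def_I !inE !eqxx orbT.
  have yx : y != x by move: uI; rewrite def_I /= inE eq_sym => /andP[].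
  have [s [s' [bs bs' sM us]]] := two x y xI yI yx.
  have M3' : size M = 3 by apply: M3; rewrite -(perm_size pI).
  have := le_M _ sM us; rewrite M3' size_cat.
  have [p0 p0'] := (pos _ _ bs, pos _ _ bs').
  have [le1 le3 | gt1 le3] := leqP (size s') 1.
    apply: (pair x y s s') => //; first by apply/eqP; rewrite eqn_leq le1.
    by rewrite -ltnS -addn1 (leq_trans _ le3) // leq_add2l.
  apply: (pair y x s' s) => //.
  + by move: sM; rewrite !all_cat andbC.
  + by rewrite (perm_uniq (ends_perm (permEl (perm_catC s' s)))).
  + by rewrite -(permPr pI) (perm_catC [:: y] [:: x]).
  + apply/eqP; rewrite eqn_leq p0 andbT -(leq_add2r 2).
    by apply: leq_trans le3; rewrite leq_add2l.
  by rewrite -ltnS -add1n (leq_trans _ le3) // leq_add2r.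
have sub : {subset [:: x; y; z] <= I}.
  by move=> v; rewrite def_I !inE orbA orbA => /orP[->|/eqP->]; rewrite ?eqxx ?orbT.
have ux : uniq [:: x; y; z].
  by move: uI; rewrite def_I -[_ :: _]/([:: x; y; z] ++ I') cat_uniq => /andP[].
have [s [s' [s'' [bs bs' bs'' sM us]]]] := three x y z ux sub.
have := le_M _ sM us; rewrite !size_cat => le3.
have [[p0 p0'] p0''] := (pos _ _ bs, pos _ _ bs', pos _ _ bs'').
have M3' : size M = 3.
  apply/eqP; rewrite eqn_leq szM; apply: leq_trans le3.
  by rewrite -[3]/(1 + (1 + 1)) !leq_add.
rewrite M3' in le3.
case: I' def_I pI => [|v I'] def_I pI; last first.
  (* A fourth blossom would be disjoint from these three. *)
  have vI : v \in I by rewrite def_I !inE eqxx !orbT.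
  have [t bt] := exB v vI; have /and4P[_ tM ut _] := bt; have pt := pos _ _ bt.
  have /and4P[nx ny nz _] : [&& v != x, v != y, v != z & true].
    move: uI; rewrite def_I -[_ :: _]/([:: x; y; z] ++ v :: I') uniq_catC /= => /andP[+ _].
    by rewrite mem_cat !inE !negb_or andbT => /andP[_].
  have [xI yI zI] : [/\ x \in I, y \in I & z \in I].
    by split; apply: sub; rewrite !inE eqxx ?orbT.
  have dt : disjoint_ends (s ++ s' ++ s'') t.
    apply: disjoint_ends_cat; first exact: dis bs bt _ _ _.
    by apply: disjoint_ends_cat; [apply: dis bs' bt _ _ _ | apply: dis bs'' bt _ _ _].
  have := le_M _ (all1 _ _ sM tM) (uniq_ends_cat us ut dt).
  rewrite M3' !size_cat leqNgt -[3]/(1 + (1 + 1)) -[X in X < _]addn0 -addnS.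
  by rewrite !leq_add.
have one a b c : 0 < a -> 0 < b -> 0 < c -> a + (b + c) <= 3 ->
    [/\ a = 1, b = 1 & c = 1].
  by case: a b c => [|[|[|a]]] [|[|b]] [|[|c]] //; rewrite ?addnS ?addSn.
have [/eqP sz1 /eqP sz2 /eqP sz3] := one _ _ _ p0 p0' p0'' le3.
move: bs bs' bs'' sM us; clear -frame pI M3' sz1 sz2 sz3.
case: s sz1 => [|g []] // _; case: s' sz2 => [|h []] // _; case: s'' sz3 => [|k []] // _.
case/and4P=> _ _ _ /andP[g1 g2]; case/and4P=> _ _ _ /andP[h1 h2].
case/and4P=> _ _ _ /andP[k1 k2] sM us; rewrite /= in g2 h2 k2.
exists (nth (ones 0, [::]) frames 5); first by [].
apply: (frame [:: g; h; k] _ _ _ sM us pI M3') =>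
    // e1 e2 e3 r [-> -> -> _].
by rewrite /adjp => a1 a2 a3; rewrite /below /= a1 a2 a3 g1 g2 h1 h2 k1 k2.
Qed.

End Frames.

(** * The types *)

(** The 2-saturating graph of weight 3, the triangle. *)
Definition types2 : seq (seq nat * seq edge) := [:: (ones 3, complete_edges 3)].

(** The 3-saturating graphs without an isolated triangle, by which the types S5,
    S6, S7, W9 and W10 arise. *)
Definition types3 : seq (seq nat * seq edge) :=
  [:: (ones 5, cyc [:: 0; 1; 2; 3; 4]);
      (ones 5, triangle 0 1 2 ++ triangle 0 3 4);
      (ones 4, complete_edges 4);
      ([:: 2; 2; 1], triangle 0 1 2);
      ([:: 2; 1; 1; 1], triangle 0 1 2 ++ [:: (0, 3)])].

(** The types that are not a disjoint union: S1, S4, S3, S2, S8 to S12 and W1 to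
    W8. This order makes the search faster. *)
Definition types4 : seq (seq nat * seq edge) :=
  let P := triangle 0 1 2 ++ [:: (0, 3)] in
  let B := triangle 0 1 2 ++ triangle 0 3 4 in
  [:: (ones 5, complete_edges 5);
      (ones 6, triangle 0 1 2 ++ triangle 3 4 5 ++ [:: (0, 3); (1, 4); (2, 5)]);
      (ones 6, triangle 0 2 3 ++ triangle 1 2 3 ++ triangle 0 4 5 ++ triangle 1 4 5);
      (ones 6, cyc [:: 0; 1; 2; 3; 4] ++ [:: (5, 0); (5, 1); (5, 2); (5, 3); (5, 4)]);
      (ones 7, cyc [:: 0; 1; 2; 3; 4; 5; 6]);
      (ones 7, triangle 0 1 2 ++ cyc [:: 0; 3; 4; 5; 6]);
      (ones 7, cyc [:: 0; 1; 2; 3; 4] ++ cyc [:: 0; 1; 2; 5; 6]);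
      (ones 7, triangle 0 1 2 ++ triangle 0 3 4 ++ triangle 0 5 6);
      (ones 7, triangle 0 1 2 ++ [:: (2, 3); (3, 4)] ++ triangle 4 5 6);
      ([:: 2; 2; 2], triangle 0 1 2);
      ([:: 3; 2; 2], triangle 0 1 2);
      ([:: 3; 3; 1], triangle 0 1 2);
      ([:: 3; 1; 1; 2], P);
      ([:: 3; 2; 1; 1], P);
      ([:: 2; 2; 2; 1], P);
      ([:: 1; 1; 2; 2; 1], triangle 0 1 2 ++ [:: (2, 3); (3, 4)]);
      ([:: 2; 2; 1; 1; 1], triangle 0 1 2 ++ [:: (0, 3); (1, 4)]);
      ([:: 1; 1; 3; 1; 1], triangle 0 1 2 ++ [:: (2, 3); (2, 4)]);
      ([:: 2; 2; 1; 1], triangle 0 1 2 ++ triangle 0 1 3);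
      ([:: 2; 1; 1; 1; 1], B);
      ([:: 2; 2; 1; 1; 1], B);
      ([:: 1; 2; 2; 1; 1], B);
      ([:: 2; 1; 1; 1; 1; 1], B ++ [:: (0, 5)]);
      ([:: 1; 2; 1; 1; 1; 1], B ++ [:: (1, 5)]);
      ([:: 2; 1; 1; 1; 1; 1], triangle 0 1 2 ++ triangle 3 4 5 ++ [:: (0, 3)]);
      ([:: 2; 2; 1; 1; 1], cyc [:: 0; 1; 2; 3; 4]);
      ([:: 2; 1; 1; 1; 1; 1], cyc [:: 0; 1; 2; 3; 4] ++ [:: (0, 5)]);
      ([:: 2; 1; 1; 1; 1; 1], cyc [:: 0; 1; 2; 3] ++ triangle 0 4 5)].

(** The nonincreasing lists of positive numbers, at most k of them and at most
    m, with sum at most n. *)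
Fixpoint weight_lists (k n m : nat) : seq (seq nat) :=
  [::] :: if k is k'.+1 then
            [seq a :: w | a <- iota 1 (minn m n), w <- weight_lists k' (n - a) a]
          else [::].

Lemma mem_weight_lists k n m w :
  size w <= k -> sumn w <= n -> path geq m w -> all (leq 1) w ->
  w \in weight_lists k n m.
Proof.
elim: k n m w => [|k IH] n m [|a w] //=.
rewrite ltnS => szw sw /andP[am pw] /andP[a0 w0]; rewrite inE /=.
have an : a <= n by apply: leq_trans (leq_addr _ _) sw.
apply: allpairs_f_dep; last by apply: IH => //; rewrite leq_subRL.
by rewrite mem_iota a0 add1n ltnS leq_min am an.
Qed.

Lemma labelling_sorted (G : wgraph) k n :
  0 < #|G| -> #|G| <= k -> \sum_(i : G) wt i <= n ->
  exists w (f : nat -> G),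
    [/\ labelling w f, w \in weight_lists k n n & 0 < size w].
Proof.
move=> G0 Gk Gn; have /card_gt0P[x0 _] := G0.
pose vs := sort (fun x y : G => wt y <= wt x) (enum G).
have pvs : perm_eq vs (enum G) by rewrite perm_sort.
have mem_vs x : x \in vs by rewrite (perm_mem pvs) mem_enum.
have us : uniq vs by rewrite (perm_uniq pvs) enum_uniq.
have sz : size vs = #|G| by rewrite (perm_size pvs) cardE.
have sum_vs : sumn [seq wt x | x <- vs] = \sum_(i : G) wt i.
  by rewrite sumnE big_map (perm_big _ pvs) big_enum.
exists [seq wt x | x <- vs], (nth x0 vs); split.
- rewrite /labelling size_map; split=> [i j | x | i lt_i].
  + by rewrite !inE => lt_i lt_j /eqP; rewrite nth_uniq // => /eqP.
  + by exists (index x vs); rewrite ?index_mem ?nth_index.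
  by rewrite (nth_map x0).
- apply: mem_weight_lists; rewrite ?size_map ?sz ?sum_vs //; last first.
    by rewrite all_map; apply/allP=> x _; apply: wt_gt0.
  have : sorted geq [seq wt x | x <- vs].
    by rewrite sorted_map; apply: sort_sorted => x y; apply: leq_total.
  case def_w: [seq wt x | x <- vs] => [|a w] //= ->; rewrite andbT.
  by apply: leq_trans Gn; rewrite -sum_vs def_w leq_addr.
by rewrite size_map sz.
Qed.

(** The search for all weights with at most k vertices and sum at most n. *)
Definition run_all t types k n : bool :=
  allb (fun w => if nilp w then true else run t types w [::]) (weight_lists k n n).

Lemma run_allP t types k n (G : wgraph) :
  run_all t types k n -> 0 < #|G| -> #|G| <= k -> \sum_(i : G) wt i <= n ->
  saturating t G -> classified types G.
Proof.
rewrite /run_all allbE => /allP runs G0 Gk Gn sat.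
have [w [f [lab wl w0]]] := labelling_sorted G0 Gk Gn.
have := runs w wl; rewrite /nilp eqn0Ngt w0.
exact: (runP sat lab (isT : below f [::])).
Qed.

Lemma run_small : run_all 4 types4 6 7.
Proof. by vm_cast_no_check (erefl true). Qed.

Lemma run_frames :
  allb (fun T => run 4 (if size T.1 == 7 then types4 else [::]) T.1 T.2) frames.
Proof. by vm_cast_no_check (erefl true). Qed.

Lemma run_three : run_all 3 types3 6 6.
Proof. by vm_cast_no_check (erefl true). Qed.

Lemma run_two : run_all 2 types2 3 3.
Proof. by vm_cast_no_check (erefl true). Qed.

Lemma card_le_weight (G : wgraph) : #|G| <= \sum_(i : G) wt i.
Proof. by rewrite -sum1_card; apply: leq_sum => i _; apply: wt_gt0. Qed.

Lemma simple_weight (G : wgraph) : \sum_(i : G) wt i <= #|G| -> forall i : G, wt i = 1.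
Proof.
move=> le i; apply/eqP; rewrite eqn_leq wt_gt0 andbT; move: le.
rewrite -sum1_card (bigD1 i) //= [X in _ <= X](bigD1 i) //=.
rewrite leqNgt; apply: contraR; rewrite -ltnNge -addSn => lt1.
by apply: leq_add => //; apply: leq_sum => j _; apply: wt_gt0.
Qed.

(** A 4-saturating graph has weight at most 9, and it is of one of the types, or
    an isolated triangle is a proper part of it. *)
Lemma classify4 (G : wgraph) : saturating 4 G -> 0 < #|G| ->
  spanned_by_one types4 G \/
  [/\ 3 < \sum_(i : G) wt i, \sum_(i : G) wt i <= 9 & isolated_triangle G].
Proof.
move=> sat G0; set n := \sum_(i : G) wt i.
have le_n : #|G| <= n by apply: card_le_weight.
have fin : n <= 9 -> classified types4 G -> spanned_by_one types4 G \/
    [/\ 3 < n, n <= 9 & isolated_triangle G].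
  move=> n9 [|[G3 iso]]; first by left.
  by right; split=> //; apply: leq_trans G3 le_n.
have frame (H : wgraph) : (forall i : H, wt i = 1) -> saturating 4 H -> 7 <= #|H| ->
    #|H| <= 9 /\ classified (if #|H| == 7 then types4 else [::]) H.
  move=> w1 satH H7; have [T TF [f [lab low]]] := frame_exists w1 satH H7.
  have := run_frames; rewrite allbE => /allP/(_ T TF) runT.
  rewrite (card_labelled lab); split; last exact: runP satH lab low runT.
  exact: (allP (isT : all (fun T => size T.1 <= 9) frames) T TF).
have [n7 | n8] := leqP n 7.
  have [G6 | G7] := leqP #|G| 6.
    apply: fin; first exact: leq_trans n7 _.
    exact: run_allP run_small G0 G6 n7 sat.
  have def_G : #|G| = 7 by apply/eqP; rewrite eqn_leq G7 (leq_trans le_n n7).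
  have w1 : forall i : G, wt i = 1 by apply: simple_weight; rewrite def_G.
  have [_] := frame G w1 sat G7; rewrite def_G eqxx; apply: fin.
  exact: leq_trans n7 _.
have B8 : 7 < #|blow G| by rewrite card_blow.
have [n9] := frame (blow G) (fun=> erefl) (saturating_blow sat) (ltnW B8).
rewrite gtn_eqF // => -[[]|[_ iso]].
right; split; [exact: leq_trans n8 | by rewrite /n -card_blow | exact: isolated_blow].
Qed.

(** * Spanning subgraphs *)

Lemma labelling_spanned (G : wgraph) w E (f : nat -> G) :
  labelling w f -> below f E -> spanned_by w E G.
Proof.
move=> lab /allP low; exists (fun i : 'I_(size w) => f i); split.
- apply: inj_card_bij => [i j /(labelled_inj lab)|]; last by rewrite (card_labelled lab) card_ord.
  by rewrite !inE !ltn_ord => /(_ isT isT)/val_inj.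
- by move=> i; apply: (labelled_wt lab).
by move=> i j /low.
Qed.

Lemma spanned_labelling (G : wgraph) w E : 0 < size w ->
  all (fun e : edge => (e.1 < size w) && (e.2 < size w)) E ->
  spanned_by w E G -> exists f : nat -> G, labelling w f /\ below f E.
Proof.
move=> w0 /allP ltE [g [bij_g wg adjg]]; pose x0 := g (Ordinal w0).
pose f i := if insub i is Some o then g o else x0.
have fE (i : 'I_(size w)) : f i = g i by rewrite /f valK.
exists f; split.
  split=> [i j | x | i lt_i].
  - rewrite !inE => lt_i lt_j; rewrite (fE (Ordinal lt_i)) (fE (Ordinal lt_j)).
    by move/(bij_inj bij_g)/(congr1 val).
  - by have [h _ gK] := bij_g; exists (h x); rewrite ?ltn_ord // fE gK.
  by rewrite (fE (Ordinal lt_i)) wg.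
apply/allP=> -[i j] ijE; have /andP[/= lt_i lt_j] := ltE _ ijE.
by rewrite (fE (Ordinal lt_i)) (fE (Ordinal lt_j)); apply: adjg.
Qed.

Lemma completeP n (G : wgraph) : 0 < n ->
  is_complete n G <-> spanned_by (ones n) (complete_edges n) G.
Proof.
move=> n0; have szn : size (ones n) = n by rewrite size_nseq.
have ltE i j : (i, j) \in complete_edges n -> [/\ i < n, j < n & i < j].
  case/allpairsPdep=> i' [j' [+ + [-> ->]]]; rewrite !mem_iota add0n => /= lt_i.
  by rewrite subnKC // => /andP[ij lt_j].
split=> [[cardG w1 adjG] | spG].
  have /card_gt0P[x0 _] : 0 < #|G| by rewrite cardG.
  have sz : size (enum G) = #|G| by rewrite -cardE.
  have := labelling_nth w1 x0 (enum_uniq G) sz; rewrite sz cardG => lab.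
  apply: labelling_spanned lab _; apply/allP=> -[i j] /ltE[lt_i lt_j ij] /=.
  by apply: adjG; rewrite nth_uniq ?enum_uniq ?sz ?cardG // ltn_eqF.
have [||f [lab /allP low]] := spanned_labelling _ _ spG; rewrite ?szn //.
  by apply/allP=> -[i j] /ltE[lt_i lt_j _] /=; rewrite lt_i lt_j.
have [_ surj wf] := lab; rewrite szn in surj wf.
split; first by rewrite (card_labelled lab).
  by move=> x; have [i lt_i <-] := surj x; rewrite wf // nth_nseq lt_i.
move=> x y; have [[i lt_i <-] [j lt_j <-]] := (surj x, surj y).
case: (ltngtP i j) => [ij _ | ji _ | -> /eqP //].
  exact: (low _ (complete_edgesP ij lt_j)).
by rewrite adj_sym; exact: (low _ (complete_edgesP ji lt_i)).
Qed.

(** A condition on (w, E) for all graphs spanned by it to be saturating. The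
    bound on the weight excludes a matching of size t. *)
Definition saturatingb t (w : seq nat) (E : seq edge) : bool :=
  [&& 0 < size w, all (fun e : edge => (e.1 < size w) && (e.2 < size w)) E,
      sumn w < t.*2 & all (packb t w E) (iota 0 (size w))].

Lemma sum_labelled (G : wgraph) w (f : nat -> G) : labelling w f ->
  \sum_(x : G) wt x = sumn w.
Proof.
move=> lab; rewrite sumnE (big_nth 0) big_mkord.
have bij_f : bijective (fun i : 'I_(size w) => f i).
  apply: inj_card_bij => [i j /(labelled_inj lab)|]; last by rewrite (card_labelled lab) card_ord.
  by rewrite !inE !ltn_ord => /(_ isT isT)/val_inj.
rewrite (reindex (fun i : 'I_(size w) => f i)) /=; last exact: onW_bij.
by apply: eq_bigr => i _; apply: (labelled_wt lab).
Qed.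

Lemma saturatingbP t w E (G : wgraph) :
  saturatingb t w E -> spanned_by w E G -> saturating t G.
Proof.
case/and4P=> w0 ltE lt_w /allP packs /(spanned_labelling w0 ltE)[f [lab low]].
apply/saturatingE; split=> [p /pmatch_size | x].
  by rewrite (sum_labelled lab) -ltn_double => /leq_ltn_trans->.
have [_ surj _] := lab; have [i lt_i <-] := surj x.
by apply: (packb_packing lab low); apply: packs; rewrite mem_iota.
Qed.

Lemma types4_saturating (G : wgraph) : spanned_by_one types4 G -> saturating 4 G.
Proof.
have /allP satT : all (fun T => saturatingb 4 T.1 T.2) types4 by vm_compute.
by case/spanned_by_oneP=> T /satT; apply: saturatingbP.
Qed.

Lemma tight_spanned t types (G : wgraph) :
  all (fun T => saturatingb t T.1 T.2 && fit t.-1 (pieces T.2) T.1) types ->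
  spanned_by_one types G -> tight t G.
Proof.
move=> /allP tt /spanned_by_oneP[T /tt/andP[satT fitT] sp].
split; first exact: saturatingbP satT sp.
have /and4P[w0 ltE _ _] := satT.
have [f [lab low]] := spanned_labelling w0 ltE sp.
by apply/nuP; exact: (fit_pmatch lab low fitT).
Qed.

Lemma types3_tight (G : wgraph) : spanned_by_one types3 G -> tight 3 G.
Proof. by apply: tight_spanned; vm_compute. Qed.

Lemma types2_tight (G : wgraph) : spanned_by_one types2 G -> tight 2 G.
Proof. by apply: tight_spanned; vm_compute. Qed.

Lemma disjoint_tight t (P : wgraph -> Prop) (G : wgraph) : 0 < t ->
  (forall H, P H -> tight t H) -> disjoint_union (is_complete 3) P G -> tight t.+1 G.
Proof. by move=> t0 tP [A [sepA A3 /tP]]; apply: tight_add. Qed.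

(** An isolated triangle gives a disjoint union with a nonempty t-saturating
    graph. *)
Lemma disjoint_classify t (P : wgraph -> Prop) (G : wgraph) :
  3 < \sum_(i : G) wt i -> saturating t.+1 G -> isolated_triangle G ->
  (forall H : wgraph, 0 < #|H| -> \sum_(i : H) wt i + 3 = \sum_(i : G) wt i ->
      saturating t H -> P H) ->
  disjoint_union (is_complete 3) P G.
Proof.
move=> G3 sat [A [sepA A3]] clP; exists A; split=> //.
have sumA := sum_rest A3; apply: clP => //; last exact: saturating_del sat.
rewrite lt0n; apply: contraTneq G3 => /card0_eq del0.
by rewrite -sumA big_pred0.
Qed.

Lemma classify2 (G : wgraph) : saturating 2 G -> 0 < #|G| -> \sum_(i : G) wt i <= 3 ->
  spanned_by_one types2 G.
Proof.
move=> sat G0 G3; have le3 := leq_trans (card_le_weight G) G3.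
by case: (run_allP run_two G0 le3 G3 sat) => // -[]; rewrite ltnNge le3.
Qed.

Lemma classify3 (G : wgraph) : saturating 3 G -> 0 < #|G| -> \sum_(i : G) wt i <= 6 ->
  spanned_by_one types3 G
  \/ disjoint_union (is_complete 3) (spanned_by_one types2) G.
Proof.
move=> sat G0 G6; have le6 := leq_trans (card_le_weight G) G6.
case: (run_allP run_three G0 le6 G6 sat) => [|[G3 iso]]; [by left | right].
have lt3 := leq_trans G3 (card_le_weight G).
apply: (disjoint_classify lt3 sat iso) => H H0 sumH satH; apply: classify2 => //.
by rewrite -(leq_add2r 3) sumH.
Qed.

Lemma disjoint_mono (P Q Q' : wgraph -> Prop) (G : wgraph) : (forall H, Q H -> Q' H) ->
  disjoint_union P Q G -> disjoint_union P Q' G.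
Proof. by move=> QQ' [A [sepA PA QA]]; exists A; split=> //; apply: QQ'. Qed.

(** The 4-saturating graphs in terms of the lists of types. *)
Lemma saturating4P (G : wgraph) : 0 < #|G| ->
  saturating 4 G <->
  [\/ spanned_by_one types4 G,
      disjoint_union (is_complete 3) (spanned_by_one types3) G
    | disjoint_union (is_complete 3)
        (disjoint_union (is_complete 3) (spanned_by_one types2)) G].
Proof.
move=> G0; split=> [sat | [/types4_saturating // | dG | dG]].
- case: (classify4 sat G0) => [|[n3 n9 iso]]; first by constructor 1.
  pose P H := spanned_by_one types3 H
    \/ disjoint_union (is_complete 3) (spanned_by_one types2) H.
  have [|A [sepA A3 [spA | dA]]] := @disjoint_classify _ P G n3 sat iso.
  + move=> H H0 sumH satH; apply: classify3 => //.
    by rewrite -(leq_add2r 3) sumH.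
  + by constructor 2; exists A.
  by constructor 3; exists A.
- by have [] := @disjoint_tight 3 _ G isT types3_tight dG.
have [] // := @disjoint_tight 3 _ G isT _ dG.
by move=> H; apply: disjoint_tight => //; apply: types2_tight.
Qed.

Lemma disjoint_types3 (G : wgraph) :
  disjoint_union (is_complete 3) (spanned_by_one types3) G <->
  [\/ [\/ S5 G, S6 G | S7 G], W9 G | W10 G].
Proof.
have K4 H := completeP H (isT : 0 < 4).
split=> [[A [sepA A3]] | [[] | |] [A [sepA A3 sp]]]; last 5 first.
- by exists A; split=> //; left.
- by exists A; split=> //; right; left.
- by exists A; split=> //; do 2 right; left; apply/K4.
- by exists A; split=> //; do 3 right; left.
- by exists A; split=> //; do 4 right; left.
case=> [sp|[sp|[/K4 sp|[sp|[sp|[]]]]]].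
- by constructor 1; constructor 1; exists A.
- by constructor 1; constructor 2; exists A.
- by constructor 1; constructor 3; exists A.
- by constructor 2; exists A.
by constructor 3; exists A.
Qed.

Lemma disjoint_types2 (G : wgraph) :
  disjoint_union (is_complete 3)
    (disjoint_union (is_complete 3) (spanned_by_one types2)) G <-> S13 G.
Proof.
have K3 H : spanned_by_one types2 H <-> is_complete 3 H.
  by split=> [[/(completeP H (isT : 0 < 3)) | []] | /(completeP H (isT : 0 < 3)) sp];
    last left.
by split; apply: disjoint_mono => H; apply: disjoint_mono => H' /K3.
Qed.

(** These two tactics find the place of one type among the others. *)
Ltac split_cases := repeat match goal with
  | H : _ \/ _ |- _ => destruct H
  | H : or3 _ _ _ |- _ => destruct H
  | H : or4 _ _ _ _ |- _ => destruct H
  | H : False |- _ => destruct H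
  end.

Ltac pick_case :=
  first [assumption | constructor 1; pick_case | constructor 2; pick_case
        | constructor 3; pick_case | constructor 4; pick_case].

Theorem theorem2p4 (Omega : wgraph) (Omega_nonempty : 0 < #|Omega|) :
  saturating 4 Omega <->
  ([\/ [\/ S1 Omega, S2 Omega, S3 Omega | S4 Omega],
       [\/ S5 Omega, S6 Omega, S7 Omega | S8 Omega],
       [\/ S9 Omega, S10 Omega, S11 Omega | S12 Omega]
     | S13 Omega]
   \/
   [\/ [\/ W1 Omega, W2 Omega, W3 Omega | W4 Omega],
       [\/ W5 Omega, W6 Omega, W7 Omega | W8 Omega],
       W9 Omega
     | W10 Omega]).
Proof.
have K5 := completeP Omega (isT : 0 < 5).
have T4 : spanned_by_one types4 Omega <->
  ([\/ [\/ spanned_by (ones 5) (complete_edges 5) Omega, S2 Omega, S3 Omega | S4 Omega], S8 Omega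
     | [\/ S9 Omega, S10 Omega, S11 Omega | S12 Omega]] \/
   [\/ [\/ W1 Omega, W2 Omega, W3 Omega | W4 Omega],
       W5 Omega, W6 Omega | (W7 Omega \/ W8 Omega)]).
  rewrite /W1 /W2 /W3 /W4 /W5 /types4 /spanned_by_one.
  split=> H; split_cases; pick_case.
apply: (iff_trans (saturating4P Omega_nonempty)); split.
  case=> [/T4 H | /disjoint_types3 H | /disjoint_types2 H].
  - split_cases; first [pick_case | left; constructor 1; constructor 1; apply/K5; assumption].
  - split_cases; pick_case.
  by left; constructor 4.
have D3 := disjoint_types3 Omega; have D2 := disjoint_types2 Omega.
move=> H; split_cases;
  first [ constructor 1; apply/T4; pick_case | constructor 2; apply/D3; pick_case
        | constructor 3; apply/D2; assumption
        | constructor 1; apply/T4; left; constructor 1; constructor 1; apply/K5; assumption].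
Qed.
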